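(* Let $Z,W,A_\star,B_\star$, the data points $\{u(t_i),x(t_i),\dot x(t_i)\}_{i=0}^{T-1}$, $\delta>0$, and $\hat Z,H$ be as in the context (in particular, the data satisfy $\dot x(t_i)=A_\star Z(x(t_i))+B_\star W(x(t_i))u(t_i)+d(t_i)$ with $|d(t_i)|^2\le\delta$ for all $i$, and $Z=H\hat Z$). Let the optimization program (OPT) in the context be feasible, let $\bar{\mathbf A},\bar{\mathbf B}$ be a solution of it, and let $\bar{\boldsymbol\zeta}:=-\bar{\mathbf A}^{-1}\bar{\mathbf B}$, $\bar{\mathbf Q}:=I_n$ and $\bar{\mathcal I}$ be the corresponding objects defined in the context. For a given symmetric polynomial matrix $\Xi:\mathbb R^n\to\mathbb R^{\hat N\times\hat N}$ and a given scalar $\varepsilon>0$, suppose there exist a matrix $P=P^\top\succ0$ in $\mathbb R^{\hat N\times\hat N}$, polynomial matrices $Y:\mathbb R^n\to\mathbb R^{m\times\hat N}$ and $\Gamma:\mathbb R\to\mathbb R^{m\times m}$, a symmetric polynomial matrix $\Theta:\mathbb R^n\to\mathbb R^{\hat N\times\hat N}$, a scalar $\eta>0$, a polynomial $\lambda$ in $(x,w)\in\mathbb R^n\times\mathbb R^m$, an SOS polynomial $s_\lambda$ in $(x,w)$, and SOS polynomial matrices $S_\Theta$ (in $x$) and $S_\partial$ (in $(x,w)$) such that for all $r\in\mathbb R$, $x\in\mathbb R^n$ and $w\in\mathbb R^m$: (a) $\Gamma(r)=\sum_{j=0}^{\nu}C_jr^{2j}$ for some integer $\nu\ge0$ and matrices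 $C_0=C_0^\top\succeq0,\dots,C_\nu=C_\nu^\top\succeq0$ with $\sum_{j=0}^{\nu}C_j\succeq\varepsilon I$; (b) $\lambda(x,w)-\varepsilon=s_\lambda(x,w)$; (c) $\Theta(x)-\eta\,\Xi(x)=S_\Theta(x)$; (d) with $L(x):=\begin{bmatrix}H(x)P\\ W(x)Y(x)\end{bmatrix}$, $E(x):=\begin{bmatrix}0\\ W(x)\end{bmatrix}\in\mathbb R^{(N+M)\times m}$ and $J(x):=\frac{\partial\hat Z(x)}{\partial x}\in\mathbb R^{\hat N\times n}$, $$\begin{bmatrix}\mathrm{Tp}\big(L(x)^\top\bar{\boldsymbol\zeta}J(x)^\top\big)+\Theta(x)+\lambda(x,w)J(x)\bar{\mathbf Q}J(x)^\top&\star&\star\\ E(x)^\top\bar{\boldsymbol\zeta}J(x)^\top&-\Gamma(|w|)&\star\\ L(x)&E(x)&-\lambda(x,w)\bar{\mathbf A}\end{bmatrix}=-S_\partial(x,w).$$ Then, if the function $b(x):=\hat Z(x)^\top P^{-1}\Xi(x)P^{-1}\hat Z(x)$ is positive definite and radially unbounded, the closed-loop system $$\dot x=[A\ \,B]\begin{bmatrix}H(x)\hat Z(x)\\ W(x)\big(Y(x)P^{-1}\hat Z(x)+w\big)\end{bmatrix}$$ is input-to-state stable (ISS) with respect to the actuator disturbance $w\in\mathbb R^m$ for all $[A\ \,B]\in\bar{\mathcal I}$, and in particular for $[A_\star\ \,B_\star]$.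
   Context: System and libraries. $x\in\mathbb R^n$ is the state and $u\in\mathbb R^m$ the input. $Z:\mathbb R^n\to\mathbb R^N$ and $W:\mathbb R^n\to\mathbb R^{M\times m}$ are known function libraries whose elements are monomials of $x$, with $Z(0)=0$. The actual system is $\dot x=A_\star Z(x)+B_\star W(x)u$ for (unknown) constant matrices $A_\star\in\mathbb R^{n\times N}$, $B_\star\in\mathbb R^{n\times M}$. Reduced library. $\hat Z:\mathbb R^n\to\mathbb R^{\hat N}$ is a polynomial vector and $H:\mathbb R^n\to\mathbb R^{N\times\hat N}$ a polynomial matrix such that $\hat Z(x)=0$ if and only if $x=0$, $Z(x)=H(x)\hat Z(x)$ for all $x$, and $|\hat Z(x)|\to\infty$ as $|x|\to\infty$. Data. There are $T$ data points $(u(t_i),x(t_i),\dot x(t_i))\in\mathbb R^m\times\mathbb R^n\times\mathbb R^n$, $i=0,\dots,T-1$, satisfying $\dot x(t_i)=A_\star Z(x(t_i))+B_\star W(x(t_i))u(t_i)+d(t_i)$ for some noise samples with $|d(t_i)|^2\le\delta$, where $\delta>0$ is known. Optimization program. Let $\ell_i:=\begin{bmatrix}Z(x(t_i))\\ W(x(t_i))u(t_i)\end{bmatrix}$, $\boldsymbol C_i:=\dot x(t_i)\dot x(t_i)^\top-\delta I$, $\boldsymbol B_i:=-\ell_i\dot x(t_i)^\top$, $\boldsymbol A_i:=\ell_i\ell_i^\top$. The program (OPT) is: minimize $-\log\det\bar{\mathbf A}$ over symmetric $\bar{\mathbf A}\in\mathbb R^{(N+M)\times(N+M)}$, $\bar{\mathbf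 B}\in\mathbb R^{(N+M)\times n}$ and scalars $\tau_0,\dots,\tau_{T-1}$, subject to $\bar{\mathbf A}\succ0$, $\tau_0\ge0,\dots,\tau_{T-1}\ge0$ and $$\begin{bmatrix}-I-\sum_{i}\tau_i\boldsymbol C_i&\star&\star\\ \bar{\mathbf B}-\sum_i\tau_i\boldsymbol B_i&\bar{\mathbf A}-\sum_i\tau_i\boldsymbol A_i&\star\\ \bar{\mathbf B}&0&-\bar{\mathbf A}\end{bmatrix}\preceq0.$$ The set $\bar{\mathcal I}$. For a solution $\bar{\mathbf A},\bar{\mathbf B}$ of (OPT), $$\bar{\mathcal I}:=\{[A\ \,B]=\zeta^\top:\ \bar{\mathbf B}^\top\bar{\mathbf A}^{-1}\bar{\mathbf B}+\bar{\mathbf B}^\top\zeta+\zeta^\top\bar{\mathbf B}+\zeta^\top\bar{\mathbf A}\zeta\preceq I\},$$ with $A\in\mathbb R^{n\times N}$, $B\in\mathbb R^{n\times M}$. Equivalently, $\bar{\mathcal I}=\{(\bar{\boldsymbol\zeta}+\bar{\mathbf A}^{-1/2}\Upsilon\bar{\mathbf Q}^{1/2})^\top:\|\Upsilon\|\le1\}$ with $\|\cdot\|$ the induced 2-norm. Notation. $|\cdot|$ is the Euclidean norm; $\succ,\succeq,\preceq$ refer to the semidefinite order on symmetric matrices; $\mathrm{Tp}(A):=A+A^\top$; $\star$ denotes the blocks making a matrix symmetric; $\frac{\partial\hat Z}{\partial x}$ is the Jacobian matrix. A function $f:\mathbb R^n\to\mathbb R$ is positive definite if $f(0)=0$ and $f(x)>0$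 for $x\ne0$, and radially unbounded if $f(x)\to\infty$ as $|x|\to\infty$. A polynomial is SOS if it is a sum of squares of polynomials; a symmetric polynomial matrix $S$ is SOS if $S=R^\top R$ for some polynomial matrix $R$. ISS. A continuous $\gamma:[0,\infty)\to[0,\infty)$ is of class $\mathcal K$ if it is strictly increasing and $\gamma(0)=0$. A continuous $\beta:[0,\infty)\times[0,\infty)\to[0,\infty)$ is of class $\mathcal{KL}$ if $\beta(\cdot,s)$ is of class $\mathcal K$ for each fixed $s$ and, for each fixed $r$, $\beta(r,\cdot)$ is decreasing with $\lim_{s\to\infty}\beta(r,s)=0$. A system $\dot x=F(x,v)$, $F(0,0)=0$, $F$ locally Lipschitz, with input $v\in\mathbb R^p$, is ISS with respect to $v$ if there exist $\beta$ of class $\mathcal{KL}$ and $\gamma$ of class $\mathcal K$ such that for each $x^\circ\in\mathbb R^n$ and each piecewise continuous bounded $v:[0,\infty)\to\mathbb R^p$, the solution with $x(0)=x^\circ$ satisfies $|x(t)|\le\beta(|x^\circ|,t)+\gamma(\sup_{s\ge0}|v(s)|)$ for all $t\ge0$. *)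

(* Defs.v *)
From HB Require Import structures.
From mathcomp Require Import all_boot all_order all_algebra.
From mathcomp Require Import all_classical all_reals all_analysis.
(* The notations of mpoly clash with those of MathComp-Analysis, so that      *)
(* [mpoly n R] is written for the polynomials in n variables over R.          *)
From mathcomp Require Import -(notations) mpoly.
Set Implicit Arguments.
Unset Strict Implicit.
Unset Printing Implicit Defensive.
Import Order.TTheory GRing.Theory Num.Theory numFieldNormedType.Exports.
Local Open Scope classical_set_scope.
Local Open Scope ring_scope.

(* The library norm [`|x|] on matrices is the sup norm. *)
Definition enorm (R : realType) (k : nat) (x : 'cV[R]_k) : R :=
  Num.sqrt (\sum_(i < k) x i 0 ^+ 2).

Definition psd (R : realType) (k : nat) (S : 'M[R]_k) : Prop :=
  S^T = S /\ forall v : 'cV[R]_k, 0 <= (v^T *m S *m v) 0 0.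

Definition posdef (R : realType) (k : nat) (S : 'M[R]_k) : Prop :=
  S^T = S /\ forall v : 'cV[R]_k, v != 0 -> 0 < (v^T *m S *m v) 0 0.

Definition psd_le (R : realType) (k : nat) (S1 S2 : 'M[R]_k) : Prop :=
  psd (S2 - S1).

Definition Tp (R : realType) (k : nat) (S : 'M[R]_k) : 'M[R]_k := S + S^T.

(* [[ S11, *, * ], [ S21, S22, * ], [ S31, S32, S33 ]] with the blocks marked *)
(* by stars filled in by transposition.                                       *)
Definition sym_block3 (R : realType) (p q r : nat)
    (S11 : 'M[R]_p)
    (S21 : 'M[R]_(q, p)) (S22 : 'M[R]_q)
    (S31 : 'M[R]_(r, p)) (S32 : 'M[R]_(r, q)) (S33 : 'M[R]_r)
    : 'M[R]_(p + (q + r)) :=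
  block_mx S11 (row_mx S21^T S31^T)
           (col_mx S21 S31) (block_mx S22 S32^T S32 S33).

Definition pev (R : realType) (n : nat) (p : mpoly n R) (x : 'cV[R]_n) : R :=
  meval (fun i => x i 0) p.

Definition mev (R : realType) (n k l : nat)
    (S : 'M[mpoly n R]_(k, l)) (x : 'cV[R]_n) : 'M[R]_(k, l) :=
  map_mx (fun p => pev p x) S.

(* A scalar coefficient, possibly zero, is allowed, so that zero entries of   *)
(* the libraries are covered.                                                 *)
Definition is_monomial (R : realType) (n : nat) (p : mpoly n R) : Prop :=
  exists (c : R) (e : multinom n), p = c *: mpolyX R e.

Definition jacobian_mx (R : realType) (n k : nat) (q : 'cV[mpoly n R]_k)
    : 'M[mpoly n R]_(k, n) :=
  \matrix_(i < k, j < n) mderiv j (q i 0).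

Definition sos (R : realType) (n : nat) (p : mpoly n R) : Prop :=
  exists qs : seq (mpoly n R), p = \sum_(q <- qs) q ^+ 2.

Definition sos_mx (R : realType) (n k : nat) (S : 'M[mpoly n R]_k) : Prop :=
  exists (l : nat) (Q : 'M[mpoly n R]_(l, k)), S = Q^T *m Q.

Definition positive_definite (R : realType) (n : nat) (f : 'cV[R]_n -> R)
    : Prop :=
  f 0 = 0 /\ forall x, x != 0 -> 0 < f x.

Definition radially_unbounded (R : realType) (n : nat) (f : 'cV[R]_n -> R)
    : Prop :=
  forall K : R, exists r : R, forall x, r <= enorm x -> K <= f x.

Definition reduced_library (R : realType) (n N Nh : nat)
    (Z : 'cV[mpoly n R]_N) (Zh : 'cV[mpoly n R]_Nh)
    (H : 'M[mpoly n R]_(N, Nh)) : Prop :=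
  [/\ forall x, mev Zh x = 0 <-> x = 0,
      forall x, mev Z x = mev H x *m mev Zh x
    & radially_unbounded (fun x => enorm (mev Zh x))].

Definition data_ell (R : realType) (n m N M : nat)
    (Z : 'cV[mpoly n R]_N) (W : 'M[mpoly n R]_(M, m))
    (x : 'cV[R]_n) (u : 'cV[R]_m) : 'cV[R]_(N + M) :=
  col_mx (mev Z x) (mev W x *m u).

Definition data_C (R : realType) (n : nat) (delta : R) (dx : 'cV[R]_n)
    : 'M[R]_n :=
  dx *m dx^T - delta%:M.

Definition data_B (R : realType) (n k : nat) (l : 'cV[R]_k) (dx : 'cV[R]_n)
    : 'M[R]_(k, n) :=
  - (l *m dx^T).

Definition data_A (R : realType) (k : nat) (l : 'cV[R]_k) : 'M[R]_k :=
  l *m l^T.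

Definition opt_feasible (R : realType) (n m N M T : nat)
    (Z : 'cV[mpoly n R]_N) (W : 'M[mpoly n R]_(M, m)) (delta : R)
    (us : 'I_T -> 'cV[R]_m) (xs dxs : 'I_T -> 'cV[R]_n)
    (Ab : 'M[R]_(N + M)) (Bb : 'M[R]_(N + M, n)) (tau : 'I_T -> R) : Prop :=
  let ell i := data_ell Z W (xs i) (us i) in
  [/\ posdef Ab,
      forall i, 0 <= tau i
    & psd_le
        (sym_block3
          (- 1%:M - \sum_(i < T) tau i *: data_C delta (dxs i))
          (Bb - \sum_(i < T) tau i *: data_B (ell i) (dxs i))
          (Ab - \sum_(i < T) tau i *: data_A (ell i))
          Bb 0 (- Ab))
        0].

Definition opt_solution (R : realType) (n m N M T : nat)
    (Z : 'cV[mpoly n R]_N) (W : 'M[mpoly n R]_(M, m)) (delta : R)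
    (us : 'I_T -> 'cV[R]_m) (xs dxs : 'I_T -> 'cV[R]_n)
    (Ab : 'M[R]_(N + M)) (Bb : 'M[R]_(N + M, n)) (tau : 'I_T -> R) : Prop :=
  opt_feasible Z W delta us xs dxs Ab Bb tau /\
  forall Ab' Bb' tau', opt_feasible Z W delta us xs dxs Ab' Bb' tau' ->
    - ln (\det Ab) <= - ln (\det Ab').

Definition Ibar (R : realType) (n k : nat)
    (Ab : 'M[R]_k) (Bb : 'M[R]_(k, n)) : set 'M[R]_(n, k) :=
  [set zeta^T | zeta in
    [set zeta : 'M[R]_(k, n) |
      psd_le (Bb^T *m invmx Ab *m Bb + Bb^T *m zeta + zeta^T *m Bb
              + zeta^T *m Ab *m zeta) 1%:M]].

Definition closed_loop (R : realType) (n m N M Nh : nat)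
    (H : 'M[mpoly n R]_(N, Nh)) (Zh : 'cV[mpoly n R]_Nh)
    (W : 'M[mpoly n R]_(M, m)) (Y : 'M[mpoly n R]_(m, Nh)) (P : 'M[R]_Nh)
    (AB : 'M[R]_(n, N + M)) (x : 'cV[R]_n) (w : 'cV[R]_m) : 'cV[R]_n :=
  AB *m col_mx (mev H x *m mev Zh x)
               (mev W x *m (mev Y x *m invmx P *m mev Zh x + w)).

(* Functions on [0, +oo[ are represented by functions on R, of which only the *)
(* restriction to [0, +oo[ is constrained.                                    *)
Definition class_K (R : realType) (g : R -> R) : Prop :=
  [/\ {within `[0, +oo[%classic, continuous g},
      {in `[0, +oo[ &, {homo g : r s / r < s}}
    & g 0 = 0].

(* "Decreasing" in the second argument cannot be strict: [b 0 s = 0] for all  *)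
(* [s].                                                                       *)
Definition class_KL (R : realType) (b : R -> R -> R) : Prop :=
  [/\ {within [set p : R * R | 0 <= p.1 /\ 0 <= p.2],
         continuous (fun p : R * R => b p.1 p.2)},
      forall s, 0 <= s -> class_K (b ^~ s),
      forall r, 0 <= r -> {in `[0, +oo[ &, {homo b r : s t / s <= t >-> t <= s}}
    & forall r, 0 <= r -> b r s @[s --> +oo] --> (0 : R)].

(* Finitely many discontinuities on bounded intervals of ]0, +oo[, and        *)
(* one-sided limits everywhere.                                               *)
Definition piecewise_continuous (R : realType) (p : nat) (v : R -> 'cV[R]_p)
    : Prop :=
  [/\ forall tf : R, finite_set [set t : R | 0 < t < tf /\ ~ {for t, continuous v}],
      forall t : R, 0 <= t -> exists l : 'cV[R]_p, v s @[s --> t^'+] --> l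
    & forall t : R, 0 < t -> exists l : 'cV[R]_p, v s @[s --> t^'-] --> l].

(* Solutions for piecewise continuous inputs: x is continuous on [0, +oo[ and *)
(* satisfies the differential equation wherever v is continuous, i.e. on each *)
(* bounded interval at all but finitely many times.                           *)
Definition is_solution (R : realType) (n p : nat)
    (F : 'cV[R]_n -> 'cV[R]_p -> 'cV[R]_n) (v : R -> 'cV[R]_p)
    (x0 : 'cV[R]_n) (x : R -> 'cV[R]_n) : Prop :=
  [/\ x 0 = x0,
      {within `[0, +oo[%classic, continuous x}
    & forall t : R, 0 < t -> {for t, continuous v} ->
        is_derive t 1 x (F (x t) (v t))].

Definition locally_lipschitz (R : realType) (n p : nat)
    (F : 'cV[R]_n -> 'cV[R]_p -> 'cV[R]_n) : Prop :=
  forall x0 v0, exists (e K : R), 0 < e /\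
    forall x y v w,
      enorm (x - x0) <= e -> enorm (y - x0) <= e ->
      enorm (v - v0) <= e -> enorm (w - v0) <= e ->
      enorm (F x v - F y w) <= K * (enorm (x - y) + enorm (v - w)).

(* "The solution satisfies ..." is rendered as: a solution on [0, +oo[        *)
(* exists, and every such solution satisfies the estimate.                    *)
Definition ISS (R : realType) (n p : nat)
    (F : 'cV[R]_n -> 'cV[R]_p -> 'cV[R]_n) : Prop :=
  [/\ F 0 0 = 0,
      locally_lipschitz F
    & exists (beta : R -> R -> R) (gamma : R -> R),
      [/\ class_KL beta, class_K gamma
        & forall (x0 : 'cV[R]_n) (v : R -> 'cV[R]_p),
          piecewise_continuous v ->
          (exists K : R, forall s, 0 <= s -> enorm (v s) <= K) ->
          (exists x, is_solution F v x0 x) /\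
          forall x, is_solution F v x0 x ->
          forall t, 0 <= t ->
            enorm (x t) <=
              beta (enorm x0) t
              + gamma (sup [set enorm (v s) | s in `[0, +oo[%classic])]].

(* Main.v *)
(* Put z = P^-1 Zh(x) and V(x) = Zh(x)^T P^-1 Zh(x). For zeta^T in the set of
   consistent matrices, D = zeta - zetab satisfies D^T Ab D <= I. Evaluating the
   quadratic form of condition (d) at (z, w, D J^T z) therefore bounds the terms
   in lambda and leaves V' <= - eta b(x) + w^T Gamma(|w|) w, which is the easy
   half of Petersen's lemma. The true matrices belong to the set: evaluate the
   LMI of (OPT) at (v, zeta v, Ab^-1 Bb v).

   Hence V is an ISS-Lyapunov function. Comparing |x|, V and b by homeomorphisms
   gives V' <= - 2 alpha(V) + c, so that at each time t either alpha(V(t)) <= c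
   or V(t) + t alpha(V(t)) <= V(0), and the inverses of r |-> r + t alpha(r)
   provide the KL bound. Solutions exist globally by Picard iteration for the
   vector field frozen outside a box, which the Lyapunov estimate prevents the
   solution from leaving. *)

Require Import Defs.
From HB Require Import structures.
From mathcomp Require Import all_boot all_order all_algebra.
From mathcomp Require Import all_classical all_reals all_analysis.
From mathcomp Require Import -(notations) mpoly.
From mathcomp Require Import measurable_realfun ring lra.
Import Order.TTheory GRing.Theory Num.Theory numFieldNormedType.Exports.
Set Implicit Arguments.
Unset Strict Implicit.
Unset Printing Implicit Defensive.
Local Open Scope classical_set_scope.
Local Open Scope ring_scope.

(** * Monotonicity away from a finite set *)

(** The input is only piecewise continuous, so the derivative of a solution is prescribed only off
    finitely many times in each bounded interval. Every estimate in time is therefore reduced to one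
    fact: a continuous function whose derivative is nonpositive off a finite set does not increase.
    The input enters only through the supremum of its norm, which makes [c] constant in time. The
    factor 2 in front of alpha comes from comparing V with [b / 2]: while alpha(V) exceeds [c], one
    copy absorbs [c] and the other is left as decay. For existence, a norm with an exponential
    weight makes Picard's operator contract on the whole half-line at once, so that no local
    solutions have to be continued. *)

Lemma nonincreasing_off_finite (R : realType) (f : R -> R) (s : seq R) (a b : R) :
  a <= b -> continuous f ->
  (forall t, a < t < b -> t \notin s ->
     exists2 d, is_derive t 1 f d & d <= 0) ->
  f b <= f a.
Proof.
move=> + cf; elim: s a b => [|c s IH] a b ab df.
  apply: (@ler0_derive1_le_cc _ f a b) => //=.
  - by move=> t; rewrite in_itv /= => /df -/(_ isT)[d ? _].
  - move=> t; rewrite in_itv /= => /df -/(_ isT)[d ? d0].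
    by rewrite derive1E derive_val.
  - exact: continuous_subspaceT.
  - by rewrite in_itv /= ab lexx.
  - by rewrite in_itv /= ab lexx.
(* On a subinterval without [c] in its interior the shorter list is enough; the interval is then cut
   at [c]. *)
have sub u v : a <= u -> v <= b -> u <= v -> ~~ (u < c < v) -> f v <= f u.
  move=> au vb uv cN; apply: IH => // t /andP[ut tv] ts; apply: df.
    by rewrite (le_lt_trans au)//= (lt_le_trans tv).
  rewrite inE negb_or ts andbT; apply: contra cN => /eqP <-.
  by rewrite ut tv.
have [/andP[ac cb]|cN] := boolP (a < c < b); last exact: sub.
apply: (@le_trans _ _ (f c)); apply: sub => //; rewrite ?ltxx ?andbF//; exact: ltW.
Qed.

Lemma le_off_finite (R : realType) (f g : R -> R) (s : seq R) (a b : R) :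
  a <= b -> continuous f -> continuous g -> f a <= g a ->
  (forall t, a < t < b -> t \notin s ->
     exists df dg, [/\ is_derive t 1 f df, is_derive t 1 g dg & df <= dg]) ->
  f b <= g b.
Proof.
move=> ab cf cg fga dfg.
have cfg : continuous (f - g) by move=> x; apply: cvgB; [exact: cf|exact: cg].
have : (f - g) b <= (f - g) a.
  apply: (@nonincreasing_off_finite _ _ s) => // t tab ts.
  have [df [dg [hf hg le]]] := dfg t tab ts.
  by exists (df - dg); [exact: is_deriveB|rewrite subr_le0].
rewrite /GRing.add /= /GRing.opp /=; lra.
Qed.

Lemma continuousT_near (R : realType) (f : R -> R) (t e : R) :
  {for t, continuous f} -> 0 < e ->
  exists2 d, 0 < d & forall s, `|s - t| < d -> `|f s - f t| < e.
Proof.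
move=> /cvgrPdist_lt/(_ e) + e0 => /(_ e0)/nbhs_ballP[d /= d0 h].
by exists d => // s st; rewrite distrC; apply: h; rewrite /ball /= distrC.
Qed.

(* It suffices that f decreases while it is in a thin layer above k, since    *)
(* by continuity f has to cross that layer in order to escape.                *)
Lemma barrier (R : realType) (f : R -> R) (s : seq R) (a b k e : R) :
  a <= b -> 0 < e -> continuous f -> f a <= k ->
  (forall t, a < t < b -> t \notin s -> k < f t < k + e ->
     exists2 d, is_derive t 1 f d & d <= 0) ->
  f b <= k.
Proof.
move=> ab e0 cf fa df; rewrite leNgt; apply/negP => kb.
pose S := [set t | a <= t <= b /\ f t <= k].
have Sa : S a by rewrite /S /= lexx ab.
have Sub : has_ubound S by exists b => t [/andP[]].
have supS : has_sup S by split => //; exists a.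
set z := sup S.
have az : a <= z by exact: ub_le_sup.
have zb : z <= b by apply: ge_sup; [exists a|move=> t [/andP[]]].
have fz : f z <= k.
  rewrite leNgt; apply/negP => kz.
  have kz0 : 0 < f z - k by rewrite subr_gt0.
  have [d d0 hd] := continuousT_near (cf z) kz0.
  have [t St tz] := sup_adherent d0 supS.
  have tz' : t <= z by exact: ub_le_sup.
  have /hd : `|t - z| < d by rewrite distrC ger0_norm ?subr_ge0//; move: tz; rewrite -/z; lra.
  by case: St => _ ftk; rewrite ltr_norml => /andP[]; lra.
have ltzb : z < b.
  by rewrite lt_neqAle zb andbT; apply/eqP => zb'; move: kb; rewrite -zb'; lra.
have [d d0 hd] := continuousT_near (cf z) e0.
(* Continuity at [z] keeps [f] below [k + e] up to [b'], so []z, b'[] lies in the layer and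
   [f b' <= f z <= k], against the choice of [z]. *)
pose b' := Num.min b (z + d / 2).
have zb' : z < b' by rewrite lt_min ltzb/=; lra.
have b'b : b' <= b by rewrite ge_min lexx.
have b'd : b' <= z + d / 2 by rewrite ge_min lexx orbT.
have above t : z < t -> t <= b' -> k < f t.
  move=> zt tb'; rewrite ltNge; apply/negP => ftk.
  have : t <= z by apply: ub_le_sup => //; split => //; apply/andP; split; lra.
  lra.
have : f b' <= f z.
  apply: (@nonincreasing_off_finite _ _ s) => //; first exact: ltW.
  move=> t /andP[zt tb'] ts; apply: df => //; first by apply/andP; split; lra.
  rewrite above ?(ltW tb')//=.
  have /hd : `|t - z| < d by rewrite ger0_norm; lra.
  by rewrite ltr_norml => /andP[_]; lra.
have := above b' zb' (lexx _); lra.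
Qed.

(** Solutions are continuous on [[0, +oo[], while the monotonicity statements concern functions
    continuous on all of R; precomposing with [Num.max 0] extends a function by its value at 0. *)
Lemma continuous_max0 (R : realType) (U : topologicalType) (f : R -> U) :
  {within `[0, +oo[, continuous f} -> continuous (f \o Num.max 0).
Proof.
move=> cf t.
have cm : {for t, continuous (Num.max 0 : R -> R)}.
  by apply: continuous_max; [exact: cvg_cst|exact: cvg_id].
have ge0 s : 0 <= Num.max (0:R) s by rewrite le_max lexx.
have m0 : `[0, +oo[%classic (Num.max 0 t) by rewrite /= in_itv/= ge0.
move/subspace_continuousP: cf => /(_ _ m0) cf.
apply: (@cvg_comp _ _ _ (Num.max 0) f (nbhs t) (within `[0, +oo[%classic (nbhs (Num.max 0 t)))) => //.
move=> A hA.
have : \forall s \near t, (Num.max 0 s \in `[0, +oo[) -> A (Num.max 0 s) := cm _ hA.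
by apply: filterS => s; apply; rewrite in_itv/= ge0.
Qed.

Lemma is_derive_max0 (R : realType) (V : normedModType R) (f g : R -> V) (t : R) (d : V) :
  0 < t -> (forall s, 0 < s -> f s = g s) -> is_derive t 1 f d -> is_derive t 1 g d.
Proof.
move=> t0 fg.
apply: near_eq_is_derive.
near=> s; apply: fg; near: s; exact: lt_nbhsr.
Unshelve. all: by end_near. Qed.

(** * Primitives of piecewise continuous functions *)

(** The interior points of continuity form an open set, on which [f] is measurable; the remaining
    points of [[a, b]] are finite in number, and every subset of them is measurable. *)
Lemma measurable_off_finite (R : realType) (f : R -> R) (a b : R) :
  finite_set [set t : R | a < t < b /\ ~ {for t, continuous f}] ->
  measurable_fun `[a, b] (f : measurableTypeR R -> measurableTypeR R).
Proof.
set D := [set t | _] => finD.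
pose U := `]a, b[%classic `\` D.
have openU : open U.
  rewrite /U setDE; apply: openI; first exact: interval_open.
  apply: closed_openC.
  apply: (proj1 (@accessible_finite_set_closed R)) => //.
  by apply: hausdorff_accessible; exact: norm_hausdorff.
have fU : measurable_fun U (f : measurableTypeR R -> measurableTypeR R).
  apply: open_continuous_measurable_fun => // t; rewrite inE => -[/= tab].
  rewrite in_itv/= in tab.
  by rewrite /D /= => /not_andP[]// /contrapT.
have -> : `[a, b]%classic = U `|` (`[a, b]%classic `&` ([set a; b] `|` D)).
  apply/seteqP; split => t /=.
    move=> tab; have [Ut|nU] := pselect (U t); [by left|right; split => //].
    rewrite in_itv/= in tab; case/andP: tab => at_ tb.
    have [->|ta] := eqVneq t a; first by left; left.
    have [->|tb'] := eqVneq t b; first by left; right.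
    right; apply: contrapT => nD; apply: nU; split => //=.
    by rewrite in_itv/= !lt_neqAle at_ tb eq_sym ta tb'.
  case=> [[+ _]|[]//]; exact: subset_itv_oo_cc.
have cE : countable (`[a, b]%classic `&` ([set a; b] `|` D)).
  apply: finite_set_countable; apply: finite_setIr.
  by rewrite finite_setU; split => //; exact: finite_set2.
have m1 (A : set R) : countable A -> measurable (A : set (measurableTypeR R)).
  by move=> cA; apply: countable_measurable => // t; exact: measurable_set1.
apply/measurable_funU.
- exact: open_measurable.
- exact: m1.
split => // _ Y mY; apply: m1.
by apply: sub_countable cE; apply: subset_card_le => x [].
Qed.

Lemma primitive_exists (R : realType) (f : R -> R) (B : R) :
  (forall t, 0 < t -> `|f t| <= B) ->
  (forall T, finite_set [set t : R | 0 < t < T /\ ~ {for t, continuous f}]) ->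
  exists F : R -> R, [/\ continuous F, forall t, t <= 0 -> F t = 0
    & forall t, 0 < t -> {for t, continuous f} -> is_derive t 1 F (f t)].
Proof.
move=> fB fD.
pose mu := @lebesgue_measure R.
pose F0 := fun t => parameterized_integral mu 0 t f.
have fint T : mu.-integrable `[0, T] (EFin \o f).
  apply: measurable_bounded_integrable => //=.
  - by rewrite lebesgue_measure_itv/=; case: ifPn => // _; rewrite -EFinB ltry.
  - exact: measurable_off_finite.
  (* [B] bounds [f] at positive times; the value at 0 is unconstrained and is added to the bound. *)
  - exists (Num.max B `|f 0|); split; first exact: num_real.
    move=> M BM t /=; rewrite in_itv/= => /andP[].
    rewrite le_eqVlt => /predU1P[<- _|t0 _]; apply: le_trans (ltW BM).
      by rewrite le_max lexx orbT.
    by rewrite le_max fB.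
have F0c : {within `[0, +oo[, continuous F0}.
  apply/continuous_within_itvcyP; split.
    move=> t; rewrite in_itv/= andbT => t0.
    have ltt : 0 < t + 1 by lra.
    have := @parameterized_integral_continuous R 0 (t + 1) f (ltW ltt) (fint _).
    move/(continuous_within_itvP _ ltt) => [+ _ _]; apply.
    by rewrite in_itv/= t0; lra.
  have := @parameterized_integral_continuous R 0 1 f ler01 (fint _).
  by move/(continuous_within_itvP _ ltr01) => [].
exists (F0 \o Num.max 0); split.
- exact: continuous_max0.
- move=> t t0; rewrite /= max_l// /F0 /parameterized_integral set_itv1.
  exact: Rintegral_set1.
- move=> t t0 cft.
  apply: (@is_derive_max0 _ _ F0) => //.
    by move=> s s0; rewrite /= max_r// ltW.
  have ltt : t < t + 1 by lra.
  have [dF eF] := continuous_FTC1_closed ltt (fint _) t0 cft.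
  by rewrite -eF derive1E; exact: derivableP.
Qed.

(** * Picard iteration *)

(** The tail of the geometric series from [k] on is [2 * C * (1 / 2) ^+ k], so the intervals of that
    radius around [u k] are nested. This gives the rate together with the limit. *)
Lemma geometric_limit (R : realType) (u : nat -> R) (C : R) :
  (forall k, `|u k.+1 - u k| <= C * (1 / 2) ^+ k) ->
  exists l, forall k, `|u k - l| <= 2 * C * (1 / 2) ^+ k.
Proof.
move=> du; set q := fun k => (1 / 2 : R) ^+ k in du *.
have q1 k : q k.+1 = q k / 2 by rewrite /q exprS; lra.
have q0 k : 0 <= q k by apply: exprn_ge0; lra.
have C0 : 0 <= C by have := du 0; rewrite /q expr0 mulr1; apply: le_trans.
pose lo k := u k - 2 * C * q k; pose hi k := u k + 2 * C * q k.
have loS k : lo k <= lo k.+1.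
  have := du k; rewrite -/(q k) /lo q1 ler_norml => /andP[]; nra.
have hiS k : hi k.+1 <= hi k.
  have := du k; rewrite -/(q k) /hi q1 ler_norml => /andP[]; nra.
have lohi j k : lo j <= hi k.
  apply: (@le_trans _ _ (lo (maxn j k))).
    by apply: (@homo_leq _ lo (fun a b => a <= b)) => //; [move=> a b c; exact: le_trans|exact: leq_maxl].
  apply: (@le_trans _ _ (hi (maxn j k))).
    by rewrite /lo /hi; have := mulr_ge0 C0 (q0 (maxn j k)); lra.
  by apply: (@homo_leq _ hi (fun a b => b <= a)) => //; [move=> a b c ab bc; exact: le_trans bc ab|exact: leq_maxr].
exists (sup (range lo)) => k.
have h1 : lo k <= sup (range lo).
  by apply: ub_le_sup; [exists (hi 0) => _ [j _ <-]; exact: lohi|exists k].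
have h2 : sup (range lo) <= hi k.
  by apply: ge_sup; [exists (lo 0); exists 0|move=> _ [j _ <-]; exact: lohi].
by move: h1 h2; rewrite -/(q k) /lo /hi ler_norml => h1 h2; apply/andP; split; lra.
Qed.

Lemma is_derive_expRM (R : realType) (a t : R) :
  is_derive t 1 (fun s => expR (a * s)) (a * expR (a * t)).
Proof.
have da : is_derive t 1 (fun s : R => a * s) a.
  have := is_deriveZ a (is_derive_id t (1 : R)).
  by rewrite /GRing.scale/= mulr1.
rewrite [a * expR _]mulrC.
exact: (@is_derive1_comp R (@expR R) (fun s : R => a * s)).
Qed.

Lemma locally_uniform_limit_continuous (R : realType) (f : R -> R) (u : nat -> R -> R)
    (C e : R) :
  0 <= C ->
  (forall k, continuous (u k)) ->
  (forall k t, `|u k t - f t| <= C * expR (e * `|t|) * (1 / 2) ^+ k) ->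
  0 <= e -> continuous f.
Proof.
move=> C0 cu uf e0 t; apply/cvgrPdist_lt => eps eps0.
(* [D] bounds the weight on the unit ball around [t], where the convergence is thus uniform. *)
pose D := C * expR (e * (`|t| + 1)).
have D0 : 0 <= D by rewrite mulr_ge0 ?expR_ge0.
have [k kD] : exists k, D * (1 / 2) ^+ k < eps / 3.
  have h : (fun k => D * (1 / 2) ^+ k) @ \oo --> (0 : R).
    rewrite -[X in _ --> X](mulr0 D); apply: cvgMr.
    by apply: cvg_expr; rewrite ger0_norm; lra.
  have e3 : 0 < eps / 3 by lra.
  move/cvgrPdist_lt: h => /(_ _ e3)[k _ /(_ k (leqnn k))] /=.
  by rewrite sub0r normrN => h; exists k; apply: le_lt_trans h; exact: ler_norm.
have close s : `|s| <= `|t| + 1 -> `|u k s - f s| < eps / 3.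
  move=> st; apply: le_lt_trans kD; apply: le_trans (uf k s) _.
  apply: ler_wpM2r; first by apply: exprn_ge0; lra.
  by rewrite ler_wpM2l// ler_expR ler_wpM2l.
have e3 : 0 < eps / 3 by lra.
have [d d0 hd] := continuousT_near (cu k t) e3.
exists (Num.min d 1); first by rewrite /= lt_min d0 ltr01.
move=> s /=; rewrite lt_min distrC => /andP[/hd + st1].
have ss : `|s| <= `|t| + 1.
  by rewrite -[s](subrK t) (le_trans (ler_normD _ _))// addrC lerD2l ltW.
have tt : `|t| <= `|t| + 1 by rewrite lerDl.
move: (close s ss) (close t tt).
rewrite !ltr_norml => /andP[? ?] /andP[? ?] /andP[? ?]; apply/andP; split; lra.
Qed.

(** [good] stands for the times at which the field is continuous along continuous curves. The global
    bound [B] makes the field integrable along every such curve, and the global Lipschitz constant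
    gives the contraction. *)
Theorem picard (R : realType) (n : nat) (G : R -> 'cV[R]_n -> 'cV[R]_n)
    (good : set R) (B K : R) (x0 : 'cV[R]_n) :
  0 <= B -> 0 <= K ->
  (forall (t : R) x i, 0 < t -> `|G t x i 0| <= B) ->
  (forall (t : R) x y i, 0 < t ->
     `|G t x i 0 - G t y i 0| <= K * \sum_j `|x j 0 - y j 0|) ->
  (forall T, finite_set [set t : R | 0 < t < T /\ ~ good t]) ->
  (forall (t : R) (x : R -> 'cV[R]_n), 0 < t -> good t ->
     (forall i, continuous (fun s => x s i 0)) ->
     forall i, {for t, continuous (fun s => G s (x s) i 0)}) ->
  exists x : R -> 'cV[R]_n, [/\ x 0 = x0, forall i, continuous (fun s => x s i 0)
    & forall t : R, 0 < t -> good t ->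
      forall i, is_derive t 1 (fun s => x s i 0) (G t (x t) i 0)].
Proof.
move=> B0 K0 GB GK finG cG.
pose cont (x : R -> 'cV[R]_n) := forall i, continuous (fun s => x s i 0).
(* The integral equation in differential form: [y] is the Picard iterate of [x], kept at [x0] for
   negative times. *)
pose step (x y : R -> 'cV[R]_n) := [/\ cont y, forall t : R, t <= 0 -> y t = x0
  & forall t : R, 0 < t -> good t ->
      forall i, is_derive t 1 (fun s => y s i 0) (G t (x t) i 0)].
have [Phi PhiP] : exists Phi, forall x, cont x -> step x (Phi x).
  suff /choice[Phi PhiP] : forall x, exists y, cont x -> step x y by exists Phi.
  move=> x; have [cx|] := pselect (cont x); last by exists x.
  have prim i := @primitive_exists _ (fun s => G s (x s) i 0) B
    (fun t t0 => GB t (x t) i t0) (fun T => sub_finite_set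
      (fun t (h : _ /\ _) => conj h.1 (fun g => h.2 (cG t x (proj1 (andP h.1)) g cx i)))
      (finG T)).
  have [F FP] := choice prim.
  exists (fun t => x0 + \col_i F i t) => _.
  have E i : (fun s => (x0 + \col_i F i s) i 0) = (fun s => x0 i 0 + F i s).
    by apply/funext => s; rewrite !mxE.
  split.
  - move=> i; rewrite E => t; apply: cvgD; first exact: cvg_cst.
    by case: (FP i) => + _ _; apply.
  - move=> t t0; apply/matrixP => i j; rewrite !mxE ord1.
    by case: (FP i) => _ /(_ _ t0) -> _; rewrite addr0.
  - move=> t t0 gt i; rewrite E.
    case: (FP i) => _ _ /(_ t t0 (cG t x t0 gt cx i)) dF.
    by rewrite -[X in is_derive _ _ _ X]add0r; apply: is_deriveD.
(* As [K * n%:R] is at most [a / 2] and [w] has derivative [a * w], a distance bounded by [c * w] is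
   halved by [Phi]. The summand 1 ensures [1 <= a], used for the first iterate. *)
pose a : R := 2 * K * n%:R + 1.
have Kn0 : 0 <= K * n%:R by rewrite mulr_ge0.
have a0 : 0 <= a by rewrite /a -mulrA; lra.
pose w (t : R) := expR (a * `|t|).
have dw (t : R) : 0 < t -> is_derive t 1 w (a * w t).
  move=> t0; rewrite /w gtr0_norm//.
  apply: (@is_derive_max0 _ _ (fun s => expR (a * s))) => //.
    by move=> s s0; rewrite gtr0_norm.
  exact: is_derive_expRM.
have w0 (t : R) : 0 <= w t by exact: expR_ge0.
have cw : continuous w.
  move=> t; apply: continuous_comp; last exact: continuous_expR.
  by apply: cvgMr; exact: norm_continuous.
(* [c * x * w] has derivative [c * x * a * w] at positive times, hence dominates the distance of two
   curves that start together. The scalar [x] is the contraction factor: 1/2 in [contr], 1 for the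
   first iterate. *)
have cmp x y z c : cont y -> cont z ->
    (forall t : R, t <= 0 -> y t = z t) -> 0 <= c ->
    (forall t : R, 0 < t -> good t -> forall i, exists dy dz,
      [/\ is_derive t 1 (fun s => y s i 0) dy,
          is_derive t 1 (fun s => z s i 0) dz
        & `|dy - dz| <= c * x * a * w t]) ->
    0 <= x -> forall (t : R) i, `|y t i 0 - z t i 0| <= c * x * w t.
  move=> cy cz yz c0 dyz x_ge0 t i.
  have [t0|t0] := leP t 0; first by rewrite yz// subrr normr0 !mulr_ge0.
  have /finite_seqP[s sP] := finG t.
  have ts r : 0 < r < t -> r \notin s -> good r.
    move=> rt rs; apply: contrapT => ngr; case/negP: rs.
    have : [set` s] r by rewrite -sP.
    by [].
  have cyzi : continuous (fun s => y s i 0 - z s i 0).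
    by move=> r; apply: cvgB; [exact: cy|exact: cz].
  have ccw : continuous (fun s => c * x * w s).
    by move=> r; apply: cvgMr; exact: cw.
  have dcw (r : R) : 0 < r -> is_derive r 1 (fun s => c * x * w s) (c * x * (a * w r)).
    by move=> r0; have := dw r r0 => ?; apply: is_deriveZ.
  rewrite ler_norml; apply/andP; split; last first.
    apply: (@le_off_finite _ (fun s => y s i 0 - z s i 0) (fun s => c * x * w s) s 0) => //.
    - exact: ltW.
    - by rewrite yz// subrr !mulr_ge0.
    - move=> r rt rs; have /andP[r0 _] := rt.
      have [dy [dz [hy hz hle]]] := dyz r r0 (ts r rt rs) i.
      exists (dy - dz), (c * x * (a * w r)); split; first exact: is_deriveB.
        exact: dcw.
      by move: hle; rewrite ler_norml mulrA => /andP[].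
  rewrite lerNl.
  apply: (@le_off_finite _ (fun s => - (y s i 0 - z s i 0)) (fun s => c * x * w s) s 0) => //.
  - exact: ltW.
  - by move=> r; apply: cvgN; exact: cyzi.
  - by rewrite yz// subrr oppr0 !mulr_ge0.
  - move=> r rt rs; have /andP[r0 _] := rt.
    have [dy [dz [hy hz hle]]] := dyz r r0 (ts r rt rs) i.
    exists (- (dy - dz)), (c * x * (a * w r)); split.
    + by apply: is_deriveN; exact: is_deriveB.
    + exact: dcw.
    + by move: hle; rewrite ler_norml mulrA lerNl => /andP[].
have contr x y c : cont x -> cont y -> 0 <= c ->
    (forall (t : R) j, `|x t j 0 - y t j 0| <= c * w t) ->
    forall (t : R) i, `|Phi x t i 0 - Phi y t i 0| <= c * (1 / 2) * w t.
  move=> cx cy c0 xy.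
  have [cPx Px0 dPx] := PhiP x cx; have [cPy Py0 dPy] := PhiP y cy.
  have half : 0 <= 1 / 2 :> R by lra.
  apply: cmp => //.
    by move=> t t0; rewrite Px0 ?Py0.
  move=> t t0 gt i; exists (G t (x t) i 0), (G t (y t) i 0).
  split; [exact: dPx|exact: dPy|].
  apply: le_trans (GK t _ _ i t0) _.
  apply: (@le_trans _ _ (K * (n%:R * (c * w t)))).
    rewrite ler_wpM2l//; apply: le_trans (ler_sum _ (fun j _ => xy t j)) _.
    by rewrite sumr_const card_ord mulr_natl.
  have := mulr_ge0 c0 (w0 t); rewrite /a; set cw_ := c * w t => ?.
  rewrite (_ : c * (1 / 2) * _ * _ = K * n%:R * cw_ + cw_ / 2); last by rewrite /cw_; field.
  by rewrite mulrA lerDl; lra.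
pose X k := iter k Phi (fun=> x0).
have cX k : cont (X k).
  by elim: k => [|k IH] /=; [move=> i t; exact: cvg_cst|have [] := PhiP _ IH].
have a1 : 1 <= a by rewrite /a -mulrA; lra.
have w1 (t : R) : 1 <= w t.
  by rewrite /w -expR0 ler_expR mulr_ge0.
have dX k (t : R) i : `|X k.+1 t i 0 - X k t i 0| <= B * (1 / 2) ^+ k * w t.
  elim: k t i => [|k IH] t i.
    have [cP P0 dP] := PhiP _ (cX 0).
    rewrite expr0; apply: cmp => //.
    move=> {}t t0 gt {}i; exists (G t x0 i 0), 0; split.
    - exact: dP.
    - exact: is_derive_cst.
    - rewrite subr0 mulr1; apply: le_trans (GB _ _ _ t0) _.
      rewrite -mulrA; apply: ler_peMr => //.
      by apply: (le_trans a1); apply: ler_peMr.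
  rewrite exprSr [B * _]mulrA; apply: (contr (X k.+1) (X k)) => //.
  by rewrite mulr_ge0// exprn_ge0//; lra.
have [l lP] : exists l : R -> 'cV[R]_n, forall t i k,
    `|X k t i 0 - l t i 0| <= 2 * (B * w t) * (1 / 2) ^+ k.
  have lim t i := @geometric_limit _ (fun k => X k t i 0) (B * w t)
    (fun k => le_trans (dX k t i) (ltac:(rewrite mulrAC; exact: lexx))).
  have [l lP] := choice (fun ti : R * 'I_n => lim ti.1 ti.2).
  exists (fun t => \col_i l (t, i)) => t i k; rewrite mxE; exact: (lP (t, i)).
have cl : cont l.
  move=> i; apply: (@locally_uniform_limit_continuous _ _ (fun k t => X k t i 0) (2 * B) a) => //.
  - lra.
  - by move=> k; exact: cX.
  - by move=> k t; have := lP t i k; rewrite mulrA.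
have [cPl Pl0 dPl] := PhiP l cl.
(* [X k.+1 = Phi (X k)] is within a multiple of [(1 / 2) ^+ k] of both [Phi l] and [l]; the constant
   4 leaves room. *)
have fixl : Phi l = l.
  apply/funext => t; apply/matrixP => i j; rewrite (ord1 j).
  apply/eqP; rewrite -subr_eq0 -normr_le0; apply/ler_addgt0Pl => e e0; rewrite addr0.
  have h : (fun k => 4 * B * w t * (1 / 2) ^+ k) @ \oo --> (0 : R).
    rewrite -[X in _ --> X](mulr0 (4 * B * w t)); apply: cvgMr.
    by apply: cvg_expr; rewrite ger0_norm; lra.
  move/cvgrPdist_lt: h => /(_ _ e0)[k _ /(_ k (leqnn k))] /=.
  rewrite sub0r normrN => /(le_lt_trans (ler_norm _)) hk; apply/ltW.
  have q0 : 0 <= (1 / 2 : R) ^+ k by apply: exprn_ge0; lra.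
  have h1 : `|X k.+1 t i 0 - Phi l t i 0| <= 2 * B * (1 / 2) ^+ k * (1 / 2) * w t.
    apply: (contr (X k)) => //; first by rewrite !mulr_ge0.
    by move=> s p; have := lP s p k; lra.
  have h2 := lP t i k.+1.
  have := mulr_ge0 (mulr_ge0 B0 (w0 t)) q0.
  move: h1 h2; rewrite exprS !ler_norml => /andP[? ?] /andP[? ?] ?.
  by rewrite ltr_norml; apply/andP; split; nra.
exists l; split => //.
- by rewrite -fixl Pl0.
- by move=> t t0 gt i; rewrite -{1}fixl; exact: dPl.
Qed.

(** * Comparison functions *)

(* Comparison functions are extended to increasing homeomorphisms of R that   *)
(* fix 0, so that inverses and continuity involve no boundary.                *)
Definition homeo0 (R : realType) (f g : R -> R) : Prop :=
  [/\ [/\ continuous f, {mono f : r s / r <= s} & f 0 = 0],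
      [/\ continuous g, {mono g : r s / r <= s} & g 0 = 0]
    & cancel f g /\ cancel g f].

Lemma homeo0_sym (R : realType) (f g : R -> R) : homeo0 f g -> homeo0 g f.
Proof. by case=> ? ? []. Qed.

Lemma homeo0_lt (R : realType) (f g : R -> R) :
  homeo0 f g -> {mono f : r s / r < s}.
Proof. by case=> -[_ + _] _ _; exact: leW_mono. Qed.

Lemma homeo0_ge0 (R : realType) (f g : R -> R) (r : R) :
  homeo0 f g -> 0 <= r -> 0 <= f r.
Proof. by case=> -[_ fm f0] _ _ r0; rewrite -f0 fm. Qed.

Lemma homeo0_class_K (R : realType) (f g : R -> R) : homeo0 f g -> class_K f.
Proof.
move=> fg; have := homeo0_lt fg; case: fg => -[cf _ f0] _ _ flt; split => //.
- exact: continuous_subspaceT.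
- by move=> r s _ _; rewrite flt.
Qed.

(** Surjectivity is the intermediate value theorem. The inverse is continuous at [y] because [f]
    maps the interval of radius [e] around [g y] onto an open interval around [y]. *)
Lemma homeo0_exists (R : realType) (f : R -> R) :
  continuous f -> {homo f : r s / r < s} -> f 0 = 0 ->
  (forall y, exists r, y <= f r) -> (forall y, exists r, f r <= y) ->
  exists g, homeo0 f g.
Proof.
move=> cf fi f0 fup fdn.
have fm : {mono f : r s / r <= s} by exact: le_mono.
have fltm : {mono f : r s / r < s} by exact: leW_mono.
have /choice[g fg] : forall y, exists r, f r = y.
  move=> y; have [b yb] := fup y; have [a ay] := fdn y.
  have ab : a <= b by rewrite -fm (le_trans ay).
  have /(IVT ab) : {within `[a, b], continuous f} by exact: continuous_subspaceT.
  move=> /(_ y)[|c _ <-]; last by exists c.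
  by rewrite min_l ?fm// max_r ?fm// ay yb.
have gf : cancel f g by move=> r; apply: (inc_inj fm); rewrite fg.
have g0 : g 0 = 0 by rewrite -[in LHS]f0 gf.
exists g; split => //; split => //.
- move=> y; apply/cvgrPdist_lt => e e0.
  have h : f (g y - e) < y < f (g y + e).
    by rewrite -{2 3}(fg y) !fltm; apply/andP; split; lra.
  have oI : open `]f (g y - e), f (g y + e)[%classic by exact: interval_open.
  near=> z; rewrite ltr_norml.
  have : z \in `]f (g y - e), f (g y + e)[.
    near: z; apply: (open_nbhs_nbhs (conj oI _)).
    by rewrite /= in_itv.
  by rewrite in_itv/= -[in X in X && _](fg z) -[in X in _ && X](fg z) !fltm => /andP[? ?];
    apply/andP; split; lra.
- by move=> y z; rewrite -fm !fg.
Unshelve. all: by end_near. Qed.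

(* The inf-convolution g r = inf_x (q x + (r - p x)^+) is the largest         *)
(* nondecreasing 1-Lipschitz function with g (p x) <= q x; the factor         *)
(* r / (1 + r) makes it strictly increasing.                                  *)
Lemma comparison_exists (R : realType) (T : Type) (p q : T -> R) (x0 : T) :
  (forall x, 0 <= p x) -> (forall x, 0 <= q x) -> p x0 = 0 -> q x0 = 0 ->
  (forall c, 0 < c -> exists2 d, 0 < d & forall x, c <= p x -> d <= q x) ->
  (forall D, exists c, forall x, c <= p x -> D <= q x) ->
  exists f g, homeo0 f g /\ forall x, f (p x) <= q x.
Proof.
move=> p0 q0 px0 qx0 pq pqy.
pose S (r : R) := [set q x + Num.max 0 (r - p x) | x in [set: T]].
pose g r := inf (S r).
have Sn r : S r !=set0 by exists (q x0 + Num.max 0 (r - p x0)); exists x0.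
have Sl r : has_lbound (S r).
  by exists 0 => _ [x _ <-]; rewrite addr_ge0// le_max lexx.
have gle r x : g r <= q x + Num.max 0 (r - p x) by apply: ge_inf => //; exists x.
have gge r c : (forall x, c <= q x + Num.max 0 (r - p x)) -> c <= g r.
  by move=> h; apply: lb_le_inf => // _ [x _ <-].
have m0 (a : R) : 0 <= Num.max 0 a by rewrite le_max lexx.
have m1 (a : R) : a <= Num.max 0 a by rewrite le_max lexx orbT.
have mP (a b : R) : 0 <= b -> a <= b -> Num.max 0 a <= b.
  by move=> ? ?; rewrite ge_max; apply/andP.
have g0 r : 0 <= g r by apply: gge => x; rewrite addr_ge0.
have gpx x : g (p x) <= q x.
  by apply: le_trans (gle _ x) _; rewrite subrr maxxx addr0.
have gm r s : r <= s -> g r <= g s.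
  move=> rs; apply: gge => x; apply: le_trans (gle r x) _.
  rewrite lerD2l; apply: mP => //.
  by apply: le_trans (m1 _); rewrite lerD2r.
have gL r s : g s <= g r + `|s - r|.
  rewrite -lerBlDr; apply: gge => x; rewrite lerBlDr.
  apply: le_trans (gle s x) _; rewrite -addrA lerD2l; apply: mP.
    by rewrite addr_ge0.
  have := m1 (r - p x); have := ler_norm (s - r); lra.
(* Either [p x] is at least [r / 2] and [q x] is bounded below by [d], or the penalty [r - p x]
   exceeds [r / 2]. *)
have gpos r : 0 < r -> 0 < g r.
  move=> r0; have r2 : 0 < r / 2 by lra.
  have [d d0 dP] := pq _ r2.
  apply: (@lt_le_trans _ _ (Num.min d (r / 2))); first by rewrite lt_min d0.
  apply: gge => x; have [h|h] := leP (r / 2) (p x).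
    by rewrite ge_min (le_trans (dP _ h))// lerDl.
  rewrite ge_min; apply/orP; right.
  have := m1 (r - p x); have := q0 x; lra.
have gy D : exists r, D <= g r.
  have [c cP] := pqy D; exists (c + `|D|); apply: gge => x.
  have [h|h] := leP c (p x); first by rewrite (le_trans (cP _ h))// lerDl.
  have := m1 (c + `|D| - p x); have := q0 x; have := ler_norm D; lra.
have cg : continuous g.
  move=> r; apply/cvgrPdist_lt => e e0; exists e => //= s /= rs.
  apply: le_lt_trans rs; rewrite ler_norml.
  by have := gL r s; have := gL s r; rewrite [`|s - r|]distrC => ? ?; apply/andP; split; lra.
pose u (r : R) := Num.max 0 r.
pose h r := 1 - (1 + u r)^-1.
have hm r s : 0 <= r -> r < s -> h r < h s.
  move=> r0 rs; have s0 : 0 < s by lra.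
  by rewrite /h /u (max_r r0) (max_r (ltW s0)) ltrD2l ltrN2 ltf_pV2 ?posrE; lra.
have h0 r : r <= 0 -> h r = 0 by move=> r0; rewrite /h /u max_l// addr0 invr1 subrr.
have h_pos r : 0 < r -> 0 < h r by move=> r0; rewrite -(h0 0)//; exact: hm.
have h_le1 r : h r <= 1.
  by rewrite /h lerBlDr lerDl invr_ge0 addr_ge0.
have cu : continuous u.
  by move=> r; apply: continuous_max; [exact: cvg_cst|exact: cvg_id].
have ch : continuous h.
  move=> r; apply: cvgB; first exact: cvg_cst.
  apply: cvgV; first by rewrite gt_eqF// ltr_pwDl.
  by apply: cvgD; [exact: cvg_cst|exact: cu].
(* Since [h] vanishes for [r <= 0], [f] is the identity there; this makes it a bijection of R. *)
pose f r := g r * h r + Num.min 0 r.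
have fN r : r <= 0 -> f r = r by move=> r0; rewrite /f h0// mulr0 add0r min_r.
have fP r : 0 <= r -> f r = g r * h r by move=> r0; rewrite /f min_l// addr0.
have cf : continuous f.
  move=> r; apply: cvgD; first by apply: cvgM; [exact: cg|exact: ch].
  by apply: continuous_min; [exact: cvg_cst|exact: cvg_id].
have fi : {homo f : r s / r < s}.
  move=> r s rs; have [s0|s0] := leP s 0; first by rewrite !fN//; lra.
  have [r0|r0] := leP r 0.
    by rewrite fN// (fP s) ?ltW// (le_lt_trans r0)// mulr_gt0// ?gpos// h_pos.
  rewrite !fP ?ltW//; apply: (@le_lt_trans _ _ (g s * h r)).
    by rewrite ler_wpM2r ?gm ?ltW// h_pos.
  by rewrite ltr_pM2l ?gpos// hm// ltW.
have f00 : f 0 = 0 by rewrite fN.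
have fy y : exists r, y <= f r.
  (* From 1 on [h] is at least 1/2, so twice the target is asked of [g]. *)
  have [r rP] := gy (2 * `|y|); pose r' := Num.max 1 r.
  have r'1 : 1 <= r' by rewrite le_max lexx.
  have gr' : 2 * `|y| <= g r' by rewrite (le_trans rP)// gm// le_max lexx orbT.
  exists r'; rewrite fP; last lra.
  have hr' : 1 / 2 <= h r'.
    have -> : 1 / 2 = h 1 by rewrite /h /u max_r//; field.
    by have [->//|?] := eqVneq r' 1; apply/ltW/hm => //; rewrite lt_neqAle eq_sym r'1 andbT.
  have := ler_norm y; have := normr_ge0 y => ? ?.
  have : 2 * `|y| * (1 / 2) <= g r' * h r' by apply: ler_pM => //; lra.
  lra.
have fNy y : exists r, f r <= y.
  by exists (Num.min 0 y); rewrite fN ge_min lexx ?orbT.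
have [fi' fi'P] := homeo0_exists cf fi f00 fy fNy.
exists f, fi'; split => // x; rewrite fP//; apply: le_trans (gpx x).
by rewrite ler_piMr.
Qed.

Lemma homeo0_comp (R : realType) (f f' g g' : R -> R) :
  homeo0 f f' -> homeo0 g g' -> homeo0 (f \o g) (g' \o f').
Proof.
move=> [[cf fm f0] [cf' fm' f0'] [ff' f'f]] [[cg gm g0] [cg' gm' g0'] [gg' g'g]].
split; split.
- by move=> r; apply: continuous_comp; [exact: cg|exact: cf].
- by move=> r s; rewrite /= fm gm.
- by rewrite /= g0 f0.
- by move=> r; apply: continuous_comp; [exact: cf'|exact: cg'].
- by move=> r s; rewrite /= gm' fm'.
- by rewrite /= f0' g0'.
- exact: can_comp.
- exact: can_comp.
Qed.

Lemma class_K_comp (R : realType) (f f' g : R -> R) :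
  homeo0 f f' -> class_K g -> class_K (f \o g).
Proof.
move=> ff' [cg gi g0]; have flt := homeo0_lt ff'; case: ff' => -[cf _ f0] _ _.
split.
- by move=> r; apply: (cvg_comp _ _ (cg r)); exact: cf.
- by move=> r s r0 s0 rs; rewrite /= flt; exact: gi.
- by rewrite /= g0.
Qed.

(* A nonincreasing y with y' <= - alpha y satisfies y t + t alpha (y t) <= y 0, *)
(* so that the inverses of the functions c |-> c + t alpha c bound y without  *)
(* solving the comparison equation.                                           *)
Lemma KL_resolvent (R : realType) (al al' : R -> R) : homeo0 al al' ->
  exists rho : R -> R -> R,
    [/\ forall t : R, homeo0 (fun c => c + `|t| * al c) (rho ^~ t),
        continuous (fun p : R * R => rho p.1 p.2),
        forall r s t : R, 0 <= r -> 0 <= s -> s <= t -> rho r t <= rho r s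
      & forall r, 0 <= r -> rho r t @[t --> +oo] --> (0 : R)].
Proof.
move=> alal'; have alt := homeo0_lt alal'; have al_ge0 := homeo0_ge0 alal'.
have [[cal alm al0] _ _] := alal'.
have inv (t : R) : exists g, homeo0 (fun c => c + `|t| * al c) g.
  have bd (y : R) : 0 <= y -> y <= y + `|t| * al y.
    by move=> y0; rewrite lerDl mulr_ge0// al_ge0.
  apply: homeo0_exists.
  - move=> c; apply: cvgD; first exact: cvg_id.
    by apply: cvgMr; exact: cal.
  - by move=> r s rs; rewrite ltr_leD// ler_wpM2l// ltW// alt.
  - by rewrite al0 mulr0 addr0.
  - by move=> y; exists `|y|; apply: (le_trans (ler_norm y)); exact: bd.
  - move=> y; exists (- `|y|); apply: (@le_trans _ _ (- `|y|)).
      by rewrite gerDl mulr_ge0_le0// -al0 alm oppr_le0.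
    by rewrite lerNl -normrN ler_norm.
have [rho0 rho0P] := choice inv; pose rho (r t : R) := rho0 t r.
have rhoE r (t : R) : rho r t + `|t| * al (rho r t) = r.
  by case: (rho0P t) => _ _ [_ +]; apply.
have rho_ge0 r (t : R) : 0 <= r -> 0 <= rho r t.
  by move=> r0; apply: (homeo0_ge0 (homeo0_sym (rho0P t))).
have rho_le r (t : R) c : r <= c + `|t| * al c -> rho r t <= c.
  move=> h; case: (rho0P t) => -[_ m _] _ _.
  by rewrite -m /= -/(rho r t) rhoE.
(* In the difference of the two defining equations both summands have the sign of [c - c'], so the
   first is bounded by the whole. [lip2] uses the same argument with [t] varying; together they give
   joint continuity. *)
have lip1 r r' (t : R) : `|rho r t - rho r' t| <= `|r - r'|.
  have := rhoE r t; have := rhoE r' t; set c := rho r t; set c' := rho r' t => <- <-.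
  have := normr_ge0 t; set tt := `|t| => t0.
  have [cc'|c'c] := leP c c'.
    have : tt * al c <= tt * al c' by rewrite ler_wpM2l// alm.
    by move=> h; rewrite !ler0_norm; lra.
  have : tt * al c' <= tt * al c by rewrite ler_wpM2l// alm ltW.
  by move=> h; rewrite !ger0_norm; lra.
have lip2 r (t t' : R) : `|rho r t - rho r t'| <= `|t - t'| * `|al (rho r t')|.
  have := rhoE r t; have := rhoE r t'; set c := rho r t; set c' := rho r t' => e e'.
  have h : (c - c') + `|t| * (al c - al c') = (`|t'| - `|t|) * al c' by lra.
  apply: (@le_trans _ _ (`|(`|t'| - `|t|) * al c'|)); last first.
    rewrite normrM ler_wpM2r// [`|t - t'|]distrC; exact: ler_dist_dist.
  rewrite -h; have := normr_ge0 t; set tt := `|t| => t0.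
  have [cc'|c'c] := leP c c'.
    have : tt * (al c - al c') <= 0 by rewrite mulr_ge0_le0// subr_le0 alm.
    by move=> ?; rewrite !ler0_norm; lra.
  have : 0 <= tt * (al c - al c') by rewrite mulr_ge0// subr_ge0 alm ltW.
  by move=> ?; rewrite !ger0_norm; lra.
exists rho; split => //.
- move=> [r0 t0]; apply/cvgrPdist_lt => e e0 /=.
  pose A := `|al (rho r0 t0)|.
  have A0 : 0 <= A by exact: normr_ge0.
  have A1 : 0 < 2 * (A + 1) by lra.
  near=> p.
  have h1 : `|r0 - p.1| < e / 2.
    near: p; apply: (@cvgr_dist_lt _ _ _ (nbhs (r0, t0)) _ fst r0 cvg_fst).
    by lra.
  have h2 : `|t0 - p.2| < e / (2 * (A + 1)).
    near: p; apply: (@cvgr_dist_lt _ _ _ (nbhs (r0, t0)) _ snd t0 cvg_snd).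
    by rewrite divr_gt0.
  have h2' : `|t0 - p.2| * (2 * (A + 1)) < e by rewrite -ltr_pdivlMr.
  rewrite distrC (le_lt_trans (ler_distD (rho r0 p.2) _ _))//.
  have := lip1 p.1 r0 p.2; have := lip2 r0 p.2 t0; rewrite -/A.
  rewrite [`|p.2 - t0|]distrC [`|p.1 - r0|]distrC => l2 l1.
  have := normr_ge0 (t0 - p.2); nra.
- move=> r s t r0 s0 st; apply: rho_le; rewrite -[X in X <= _](rhoE r s) lerD2l.
  by rewrite ler_wpM2r ?al_ge0 ?rho_ge0// !ger0_norm// (le_trans s0).
- move=> r r0; apply/cvgrPdist_le => e e0.
  (* For [t >= r / al e] one has [r <= e + t * al e], hence [rho r t <= e]. *)
  have ae : 0 < al e by rewrite -al0 alt.
  near=> t.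
  rewrite sub0r normrN ger0_norm ?rho_ge0//; apply: rho_le.
  have t0 : 0 <= t by near: t; apply: nbhs_pinfty_ge; exact: num_real.
  have tr : r / al e <= t by near: t; apply: nbhs_pinfty_ge; exact: num_real.
  rewrite ger0_norm//; move: tr; rewrite ler_pdivrMr//; lra.
Unshelve. all: by end_near. Qed.

(** If [al (y t)] exceeds [c], then [y] was nowhere on [[0, t]] below [y t], since levels from
    [al' c] on cannot be crossed upwards. Hence the derivative is at most [- al (y t)] off the
    exceptional times of []0, t[], and integration gives the second alternative. *)
Lemma decay_dichotomy (R : realType) (al al' y : R -> R) (c : R) :
  homeo0 al al' -> 0 <= c -> continuous y ->
  (forall T, exists s : seq R, forall t : R, 0 < t < T -> t \notin s ->
     exists2 d, is_derive t 1 y d & d <= - (2 * al (y t)) + c) ->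
  forall t : R, 0 <= t -> al (y t) <= c \/ y t + t * al (y t) <= y 0.
Proof.
move=> alal' c0 cy dy t t0; have alt := homeo0_lt alal'.
have [[_ alm _] _ [_ al'K]] := alal'.
have [|cd] := leP (al (y t)) c; [by left|right].
have [s sP] := dy t.
have above r : 0 <= r -> r <= t -> y t <= y r.
  move=> r0 rt; rewrite leNgt; apply/negP => yrt.
  have : y t <= Num.max (al' c) (y r).
    apply: (@barrier _ y s r t _ 1) => //; first by rewrite le_max lexx orbT.
    move=> u /andP[ru ut] us /andP[]; rewrite gt_max => /andP[cu _] _.
    have uT : 0 < u < t by rewrite ut (le_lt_trans r0).
    have [d dyu dle] := sP u uT us; exists d => //.
    move: cu; rewrite -alt al'K; lra.
  rewrite le_max => /orP[|]; last by rewrite leNgt yrt.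
  by rewrite -alm al'K leNgt cd.
have h : y t + t * al (y t) <= y 0 + 0 * al (y t).
  pose f r := y r + r * al (y t).
  apply: (@nonincreasing_off_finite _ f s 0 t) => //.
    move=> r; apply: cvgD; first exact: cy.
    by apply: cvgMl; exact: cvg_id.
  move=> r rt rs; have /andP[r0 rt'] := rt.
  have [d dyr dle] := sP r rt rs; exists (d + al (y t)).
    apply: is_deriveD.
    have -> : (fun r : R => r * al (y t)) = (fun r => al (y t) * r).
      by apply/funext => ?; rewrite mulrC.
    have := is_deriveZ (al (y t)) (is_derive_id r (1 : R)).
    by rewrite /GRing.scale/= mulr1.
  have := above r (ltW r0) (ltW rt'); rewrite -alm; lra.
by move: h; rewrite mul0r addr0.
Qed.

(** * Compactness for the Euclidean norm *)

Lemma sqr_enorm (R : realType) (k : nat) (x : 'cV[R]_k) :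
  enorm x ^+ 2 = \sum_(i < k) x i 0 ^+ 2.
Proof. by rewrite sqr_sqrtr// sumr_ge0// => i _; exact: sqr_ge0. Qed.

Lemma enorm_ge0 (R : realType) (k : nat) (x : 'cV[R]_k) : 0 <= enorm x.
Proof. exact: sqrtr_ge0. Qed.

Lemma enorm0 (R : realType) (k : nat) : enorm (0 : 'cV[R]_k) = 0.
Proof. by rewrite /enorm big1 ?sqrtr0// => i _; rewrite mxE expr0n. Qed.

Lemma coord_le_enorm (R : realType) (k : nat) (x : 'cV[R]_k) (i : 'I_k) :
  `|x i 0| <= enorm x.
Proof.
rewrite -sqrtr_sqr; apply: ler_wsqrtr.
by rewrite (bigD1 i)//= lerDl sumr_ge0// => j _; exact: sqr_ge0.
Qed.

Lemma enorm_le_sum (R : realType) (k : nat) (x : 'cV[R]_k) :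
  enorm x <= \sum_i `|x i 0|.
Proof.
have s0 : 0 <= \sum_i `|x i 0| by exact: sumr_ge0.
rewrite -(ler_pXn2r (_ : 0 < 2)%N) ?nnegrE ?enorm_ge0// sqr_enorm.
rewrite expr2 mulr_suml; apply: ler_sum => i _.
rewrite -real_normK ?num_real// expr2 ler_wpM2l// (bigD1 i)//= lerDl; exact: sumr_ge0.
Qed.

Lemma mx_norm_le_enorm (R : realType) (k : nat) (x : 'cV[R]_k) : `|x| <= enorm x.
Proof.
rewrite [leLHS]/Num.Def.normr/= mx_normrE (bigmax_le _ (enorm_ge0 x))// => -[i j] _.
by rewrite (ord1 j) coord_le_enorm.
Qed.

Lemma continuous_colP (R : realType) (T : topologicalType) (k : nat)
    (x : T -> 'cV[R]_k) (t : T) :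
  {for t, continuous x} <-> forall i, {for t, continuous (fun s => x s i 0)}.
Proof.
split=> [cx i|cx].
  exact: (@continuous_comp _ _ _ x (fun M : 'cV[R]_k => M i 0) t cx (@coord_continuous R k 1 i 0 (x t))).
apply/cvgrPdist_le => e e0; near=> s.
rewrite [leLHS]/Num.Def.normr/= mx_normrE (bigmax_le _ (ltW e0))//= => -[i j] _.
rewrite !mxE/= (ord1 j).
move: i {j}; near: s; apply: filter_forall => i.
exact: ((cvgrPdist_le _ _).1 (cx i)).
Unshelve. all: by end_near. Qed.

Lemma is_derive_colP (R : realType) (k : nat) (x : R -> 'cV[R]_k) (t : R)
    (d : 'cV[R]_k) :
  is_derive t 1 x d <-> forall i, is_derive t 1 (fun s => x s i 0) (d i 0).
Proof.
split=> [[dx <-] i|dx].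
  have dxi := (derivable_mxP x t 1).1 dx i 0.
  by split => //; rewrite derive_mx// mxE.
have dx' : derivable x t 1.
  by apply/derivable_mxP => i j; rewrite (ord1 j); case: (dx i).
split => //; rewrite derive_mx//; apply/matrixP => i j; rewrite mxE (ord1 j).
by case: (dx i).
Qed.

Lemma continuous_enorm (R : realType) (k : nat) : continuous (@enorm R k).
Proof.
have cs : continuous (fun x : 'cV[R]_k => \sum_i x i 0 ^+ 2).
  apply: continuous_big => [|i _ y]; first exact: add_continuous.
  have cy := @coord_continuous R k 1 i 0 y.
  exact: (cvgM cy cy).
move=> x; apply: (@continuous_comp _ _ _ _ _ x (cs x)).
exact: sqrt_continuous.
Qed.

Lemma continuous_trmx (R : realType) (k : nat) :
  continuous (@trmx R 1 k).
Proof.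
move=> x; apply/continuous_colP => i.
have -> : (fun s : 'rV[R]_k => s^T i 0) = (fun s => s 0 i).
  by apply/funext => s; rewrite mxE.
exact: coord_continuous.
Qed.

Lemma annulus_min (R : realType) (k : nat) (f : 'cV[R]_k -> R) (a b : R) :
  continuous f -> (exists x : 'cV[R]_k, a <= enorm x <= b) ->
  exists2 x, a <= enorm x <= b & forall y, a <= enorm y <= b -> f x <= f y.
Proof.
move=> cf [x0 x0P].
pose A := [set x : 'rV[R]_k | a <= enorm x^T <= b].
have cA : compact A.
  apply: bounded_closed_compact.
    exists b; split; first exact: num_real.
    move=> M bM x /= /andP[_ xb].
    rewrite [leLHS]/Num.Def.normr/= mx_normrE.
    have b0 : 0 <= b := le_trans (enorm_ge0 _) xb.
    apply: bigmax_le => [|[i j] _]; first by rewrite (le_trans b0)// ltW.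
    have := coord_le_enorm x^T j; rewrite mxE (ord1 i) => h.
    by rewrite (le_trans h)// (le_trans xb)// ltW.
  have -> : A = (fun x : 'rV[R]_k => enorm x^T) @^-1` `[a, b]%classic.
    by apply/seteqP; split => x; rewrite /A /= in_itv.
  apply: preimage_closed; last exact: itv_closed.
  by move=> x _; apply: continuous_comp; [exact: continuous_trmx|exact: continuous_enorm].
have [||c] := @EVT_min_rV R k (fun x => f x^T) A _ cA.
- by exists x0^T; rewrite /A /= trmxK.
- apply: continuous_subspaceT => x.
  by apply: continuous_comp; [exact: continuous_trmx|exact: cf].
rewrite inE /A /= => cab cmin; exists c^T => // y yab.
by have := cmin y^T; rewrite inE /A /= trmxK; apply.
Qed.

Lemma continuous_bounded_enorm (R : realType) (k : nat) (f : 'cV[R]_k -> R) (D : R) :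
  continuous f -> exists c, forall x, enorm x <= D -> f x <= c.
Proof.
move=> cf; have [D0|D0] := leP 0 D; last first.
  by exists 0 => x xD; have := enorm_ge0 x; lra.
have cNf : continuous (fun x => - f x) by move=> x; exact: (cvgN (cf x)).
have [|x _ xP] := @annulus_min R k (fun x => - f x) 0 D cNf.
  by exists 0; rewrite enorm0 lexx.
exists (f x) => y yD; rewrite -lerN2; apply: xP.
by rewrite enorm_ge0.
Qed.

Lemma positive_definite_ge0 (R : realType) (k : nat) (f : 'cV[R]_k -> R) x :
  positive_definite f -> 0 <= f x.
Proof.
move=> [f0 fp]; have [->|/fp/ltW//] := eqVneq x 0; by rewrite f0.
Qed.

(** Radial growth gives the bound 1 outside a large ball; the annulus that remains is compact, so a
    positive minimum is attained on it. *)
Lemma positive_definite_lower (R : realType) (k : nat) (f : 'cV[R]_k -> R) (c : R) :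
  continuous f -> positive_definite f -> radially_unbounded f -> 0 < c ->
  exists2 d, 0 < d & forall x, c <= enorm x -> d <= f x.
Proof.
move=> cf [f0 fp] /(_ 1)[r rP] c0.
(* The annulus is empty if [r < c], and always in dimension 0. *)
have [ex|nex] := pselect (exists x : 'cV[R]_k, c <= enorm x <= r); last first.
  exists 1 => // x cx; apply: rP; rewrite leNgt; apply/negP => xr.
  by apply: nex; exists x; rewrite cx ltW.
have [x /andP[cx _] xP] := annulus_min cf ex.
exists (Num.min 1 (f x)).
  rewrite lt_min ltr01 fp//; apply/eqP => x0.
  by move: cx; rewrite x0 enorm0; lra.
move=> y cy; rewrite ge_min; have [ry|yr] := leP r (enorm y); first by rewrite rP.
by rewrite xP ?orbT// cy ltW.
Qed.

(** * ISS from a Lyapunov function *)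

(** Clipping acts on each coordinate, so it is nonexpansive coordinatewise, in the form that the
    Lipschitz hypothesis of [picard] asks for. *)
Definition clip (R : realType) (n : nat) (r : R) (x : 'cV[R]_n) : 'cV[R]_n :=
  \col_i Num.max (- r) (Num.min r (x i 0)).

Lemma clip_le (R : realType) (n : nat) (r : R) (x : 'cV[R]_n) i :
  0 <= r -> `|clip r x i 0| <= r.
Proof.
move=> r0; rewrite mxE ler_norml le_max lexx/= ge_max ge_min lexx andbT; lra.
Qed.

Lemma clip_id (R : realType) (n : nat) (r : R) (x : 'cV[R]_n) :
  (forall i, `|x i 0| <= r) -> clip r x = x.
Proof.
move=> xr; apply/matrixP => i j; rewrite mxE (ord1 j).
by have := xr i; rewrite ler_norml => /andP[? ?]; rewrite min_r// max_r.
Qed.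

Lemma clip_lip (R : realType) (n : nat) (r : R) (x y : 'cV[R]_n) i :
  `|clip r x i 0 - clip r y i 0| <= `|x i 0 - y i 0|.
Proof.
have mono (a b : R) : a <= b ->
    0 <= Num.max (- r) (Num.min r b) - Num.max (- r) (Num.min r a) <= b - a.
  move=> ab; case: (leP r b) => ?; case: (leP r a) => ?; case: (leP (- r) r) => ?;
    case: (leP (- r) a) => ?; case: (leP (- r) b) => ?; apply/andP; split; lra.
rewrite !mxE; have [xy|/ltW yx] := leP (x i 0) (y i 0).
  have := mono _ _ xy => /andP[? ?].
  by rewrite !ler0_norm//; lra.
have := mono _ _ yx => /andP[? ?].
by rewrite !ger0_norm//; lra.
Qed.

Lemma clip_continuous (R : realType) (n : nat) (r : R) : continuous (@clip R n r).
Proof.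
move=> x; apply/continuous_colP => i.
have -> : (fun s : 'cV[R]_n => clip r s i 0) =
    (fun s => Num.max (- r) (Num.min r (s i 0))).
  by apply/funext => s; rewrite mxE.
apply: (@continuous_max _ _ (fun=> - r) (fun s : 'cV[R]_n => Num.min r (s i 0))).
  exact: cst_continuous.
apply: (@continuous_min _ _ (fun=> r) (fun s : 'cV[R]_n => s i 0)).
  exact: cst_continuous.
exact: coord_continuous.
Qed.

Lemma class_K_le (R : realType) (g : R -> R) (r s : R) :
  class_K g -> 0 <= r -> r <= s -> g r <= g s.
Proof.
move=> [_ gi _] r0; rewrite le_eqVlt => /predU1P[->//|rs]; apply/ltW/gi => //.
  by rewrite in_itv/= r0.
by rewrite in_itv/= (le_trans r0)// ltW.
Qed.

Theorem lyapunov_ISS (R : realType) (n p : nat)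
    (F : 'cV[R]_n -> 'cV[R]_p -> 'cV[R]_n) (V b : 'cV[R]_n -> R) (sg : R -> R) :
  F 0 0 = 0 -> locally_lipschitz F ->
  (forall r : R, exists B K : R, forall (x y : 'cV[R]_n) (v : 'cV[R]_p),
     (forall i, `|x i 0| <= r) -> (forall i, `|y i 0| <= r) -> enorm v <= r ->
     forall i, `|F x v i 0| <= B /\
       `|F x v i 0 - F y v i 0| <= K * \sum_j `|x j 0 - y j 0|) ->
  (forall (x : R -> 'cV[R]_n) (v : R -> 'cV[R]_p) (t : R),
     {for t, continuous x} -> {for t, continuous v} ->
     {for t, continuous (fun s => F (x s) (v s))}) ->
  continuous V -> positive_definite V -> radially_unbounded V ->
  continuous b -> positive_definite b -> radially_unbounded b ->
  class_K sg ->
  (forall (x : R -> 'cV[R]_n) (t : R) (v : 'cV[R]_p), is_derive t 1 x (F (x t) v) ->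
     exists2 d, is_derive t 1 (V \o x) d & d <= - b (x t) + sg (enorm v)) ->
  ISS F.
Proof.
move=> F00 Flip Fbd Fc cV posV radV cb posb radb Ksg dV; split => //.
have V_ge0 x := positive_definite_ge0 x posV.
have b_ge0 x := positive_definite_ge0 x posb.
have [V0 _] := posV; have [b0 _] := posb.
have low (f : 'cV[R]_n -> R) := @positive_definite_lower R n f.
have [a1 [a1' [A1 a1P]]] : exists f g, homeo0 f g /\ forall x : 'cV[R]_n, f (enorm x) <= V x.
  apply: (@comparison_exists _ _ (@enorm R n) V 0) => //; first exact: enorm_ge0.
  - exact: enorm0.
  - by move=> c; exact: low.
have VE (c : R) : 0 < c -> exists2 d, 0 < d & forall x, c <= V x -> d <= enorm x.
  move=> c0; have /cvgrPdist_lt/(_ c c0)/nbhs_ballP[d /= d0 dP] := cV 0.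
  exists d => // x cx; rewrite leNgt; apply/negP => xd.
  have : ball 0 d x.
    by rewrite mx_norm_ball /ball_/= sub0r normrN (le_lt_trans (mx_norm_le_enorm x)).
  move=> /dP; rewrite V0 sub0r normrN ger0_norm//; lra.
have [k [k' [Hk kP]]] : exists f g, homeo0 f g /\ forall x : 'cV[R]_n, f (V x) <= enorm x.
  apply: (@comparison_exists _ _ V (@enorm R n) 0) => //; first exact: enorm_ge0.
  - exact: enorm0.
  - move=> D; have [c cP] := continuous_bounded_enorm D cV.
    exists (c + 1) => x cx; rewrite leNgt; apply/negP => /ltW/cP; lra.
have [al [al' [Hal alP]]] : exists f g, homeo0 f g /\ forall x : 'cV[R]_n, f (V x) <= b x / 2.
  apply: (@comparison_exists _ _ V (fun x => b x / 2) 0) => //.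
  - by move=> x; rewrite divr_ge0.
  - by rewrite b0 mul0r.
  - move=> c /VE[d d0 dP]; have [e e0 eP] := low b d cb posb radb d0.
    exists (e / 2); first lra.
    by move=> x /dP/eP; lra.
  - move=> D; have [r rP] := radb (2 * D).
    have [c cP] := continuous_bounded_enorm r cV.
    exists (c + 1) => x cx.
    have /rP : r <= enorm x by rewrite leNgt; apply/negP => /ltW/cP; lra.
    lra.
have [rho [rhoH crho rho_dec rho0]] := KL_resolvent Hal.
have [[ca1' a1'm a1'0] _ _] := homeo0_sym A1.
have [[ck' k'm k'0] _ _] := homeo0_sym Hk.
have k'_ge0 := homeo0_ge0 (homeo0_sym Hk).
have sg0 r : 0 <= r -> 0 <= sg r.
  by move=> r0; case: (Ksg) => _ _ <-; exact: class_K_le.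
(* [k (V x) <= enorm x] gives [V x0 <= k' (enorm x0)]; [rho] carries this bound to time [t], and
   [a1'] turns a bound on [V] into one on the norm. The gain applies [a1'] to the level
   [al' (sg S)]. *)
exists (fun r t => a1' (rho (k' r) t)), (a1' \o (al' \o sg)); split.
- split.
  + apply: continuous_subspaceT => -[r t] /=.
    apply: (@continuous_comp _ _ _ (fun q : R * R => rho (k' q.1) q.2)); last exact: ca1'.
    apply: (@continuous_comp _ _ _ (fun q : R * R => (k' q.1, q.2))
       (fun q : R * R => rho q.1 q.2)); last exact: crho.
    have h1 : k' q.1 @[q --> (r, t)] --> k' r.
      exact: (@cvg_comp _ _ _ fst k' _ _ _ cvg_fst (ck' r)).
    exact: (cvg_pair h1 cvg_snd).
  + move=> t _; apply: (@homeo0_class_K _ (a1' \o ((rho ^~ t) \o k'))).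
    apply: (homeo0_comp (homeo0_sym A1)).
    exact: (homeo0_comp (homeo0_sym (rhoH t)) (homeo0_sym Hk)).
  + move=> r r0 s t; rewrite !in_itv/= !andbT => s0 t0 st.
    by rewrite a1'm rho_dec// k'_ge0.
  + move=> r r0; rewrite -[X in _ --> X]a1'0.
    by apply: (cvg_comp _ _ (rho0 _ (k'_ge0 _ r0))); exact: ca1'.
- apply: (class_K_comp (homeo0_sym A1)).
  exact: (class_K_comp (homeo0_sym Hal)).
move=> x0 v pcv [Kv KvP].
set S := sup _.
have vS s : 0 <= s -> enorm (v s) <= S.
  move=> s0; apply: ub_le_sup; last by exists s => //=; rewrite in_itv/= s0.
  by exists Kv => _ [u /= + <-]; rewrite in_itv/= andbT => /KvP.
have S0 : 0 <= S by apply: le_trans (vS 0 (lexx 0)); exact: enorm_ge0.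
pose c := sg S; have c0 : 0 <= c by exact: sg0.
have [fin_disc _ _] := pcv.
have discP (T : R) : exists s : seq R, forall t : R, 0 < t < T -> t \notin s ->
    {for t, continuous v}.
  have /finite_seqP[s sP] := fin_disc T; exists s => t tT ts.
  apply: contrapT => nc; case/negP: ts.
  have : [set` s] t by rewrite -sP.
  by [].
have dV' (x : R -> 'cV[R]_n) (t : R) : 0 <= t -> is_derive t 1 x (F (x t) (v t)) ->
    exists2 d, is_derive t 1 (V \o x) d & d <= - (2 * al (V (x t))) + c.
  move=> t0 /dV[d dd dle]; exists d => //; apply: le_trans dle _.
  have := alP (x t); have := class_K_le Ksg (enorm_ge0 (v t)) (vS t t0).
  rewrite -/c; lra.
have alt := homeo0_lt Hal; have [[_ alm _] _ [_ al'K]] := Hal.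
split; last first.
  move=> x [x_0 cx dx] t t0.
  pose y := (V \o x) \o Num.max 0.
  have cy : continuous y.
    apply: continuous_max0 => s; apply: (cvg_comp _ _ (cx s)); exact: cV.
  have yE (s : R) : 0 <= s -> y s = V (x s) by move=> s0; rewrite /y /= max_r.
  (* Each alternative bounds the norm by one of the two summands; the other summand is
     nonnegative. *)
  have [|h|h] := @decay_dichotomy _ al al' y c Hal c0 cy _ t t0.
  + move=> T; have [s sP] := discP T; exists s => u uT us.
    have /andP[u0 _] := uT.
    have [d dd dle] := dV' x u (ltW u0) (dx u u0 (sP u uT us)).
    exists d; last by rewrite yE// ltW.
    apply: (@is_derive_max0 _ _ (V \o x)) => // w w0.
    by rewrite yE// ltW.
  + rewrite -[leLHS]add0r lerD//.
      rewrite -a1'0 a1'm.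
      apply: (homeo0_ge0 (homeo0_sym (rhoH t))); exact/k'_ge0/enorm_ge0.
    rewrite -/S /=; have [[_ a1m _] _ [_ a1'K]] := A1.
    rewrite -a1m a1'K; apply: le_trans (a1P _) _.
    by rewrite -alm al'K -yE.
  + have [[_ a1m _] _ [_ a1'K]] := A1.
    have [[_ km _] _ [_ k'K]] := Hk.
    rewrite -[leLHS]addr0 lerD//; last first.
      rewrite -/S /= -a1'0 a1'm.
      by apply: (homeo0_ge0 (homeo0_sym Hal)).
    rewrite -a1m a1'K; apply: le_trans (a1P _) _.
    have [[_ rm _] _ [_ rK]] := rhoH t.
    rewrite -rm rK ger0_norm// -yE//; apply: le_trans h _.
    by rewrite yE// x_0 -km k'K.
(* Above [al' c] the function [V] decreases along solutions. The box of radius [r] contains the set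
   [V <= k0 + 1], the extra 1 being the layer of [barrier]; [r] also dominates [S], because [Fbd]
   has one radius for state and input. *)
pose k0 := Num.max (V x0) (al' c).
pose r := Num.max S (a1' (k0 + 1)).
have r0 : 0 <= r by rewrite le_max S0.
have [B [K BK]] := Fbd r.
have [a1m a1'K] : {mono a1 : r s / r <= s} /\ cancel a1' a1 by case: A1 => -[_ ? _] _ [].
have inbox x : V x <= k0 + 1 -> clip r x = x.
  move=> Vx; apply: clip_id => i; apply: le_trans (coord_le_enorm x i) _.
  rewrite le_max; apply/orP; right.
  by rewrite -a1m a1'K (le_trans (a1P _)).
have vr (t : R) : 0 < t -> enorm (v t) <= r by move=> /ltW/vS h; rewrite le_max h.
have [z [z0 cz dz]] : exists z : R -> 'cV[R]_n, [/\ z 0 = x0,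
    forall i, continuous (fun s => z s i 0)
    & forall t : R, 0 < t -> {for t, continuous v} -> forall i,
        is_derive t 1 (fun s => z s i 0) (F (clip r (z t)) (v t) i 0)].
  apply: (@picard R n (fun t x => F (clip r x) (v t))
    [set t | {for t, continuous v}] `|B| `|K| x0) => //.
  - move=> t x i t0.
    have [h _] := BK _ (clip r x) _ (fun i => clip_le x i r0)
      (fun i => clip_le x i r0) (vr t t0) i.
    exact: le_trans h (ler_norm B).
  - move=> t x y i t0.
    have [_ h] := BK _ (clip r y) _ (fun i => clip_le x i r0)
      (fun i => clip_le y i r0) (vr t t0) i.
    apply: (le_trans h).
    apply: (@le_trans _ _ (`|K| * \sum_j `|clip r x j 0 - clip r y j 0|)).
      by rewrite ler_wpM2r ?ler_norm// sumr_ge0.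
    by rewrite ler_wpM2l//; apply: ler_sum => j _; exact: clip_lip.
  - move=> t x t0 ct cx; apply/continuous_colP; apply: Fc => //.
    apply: (continuous_comp (f := x)); last exact: clip_continuous.
    by apply/continuous_colP => i; exact: cx.
have cz' : continuous z by move=> t; apply/continuous_colP => i; exact: cz.
have cVz : continuous (V \o z).
  by move=> t; apply: continuous_comp; [exact: cz'|exact: cV].
have dz' (t : R) : 0 < t -> {for t, continuous v} -> clip r (z t) = z t ->
    is_derive t 1 z (F (z t) (v t)).
  move=> t0 ct cl; apply/is_derive_colP => i.
  by have := dz t t0 ct i; rewrite cl.
have Vz (t : R) : 0 <= t -> V (z t) <= k0.
  move=> t0; have [s sP] := discP t.
  apply: (@barrier _ (V \o z) s 0 t k0 1) => //; first by rewrite /= z0 le_max lexx.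
  (* In the layer [k0 < V < k0 + 1] clipping is inactive, so [z] obeys the true equation there and
     [V] decreases. *)
  move=> u ut us /= /andP[ku uk]; have /andP[u0 _] := ut.
  have [d dd dle] := dV' z u (ltW u0) (dz' u u0 (sP u ut us) (inbox _ (ltW uk))).
  exists d => //; apply: le_trans dle _.
  move: ku; rewrite gt_max => /andP[_]; rewrite -alt al'K; lra.
exists z; split => //; first exact: continuous_subspaceT.
move=> t t0 ct; apply: dz' => //; apply: inbox.
by apply: le_trans (Vz t (ltW t0)) _; rewrite lerDl.
Qed.

(** * Polynomial functions *)

Lemma mpoly_ring_ind (R : realType) (n : nat) (Q : mpoly n R -> Prop) :
  (forall c, Q (mpolyC n c)) -> (forall i, Q (mpolyX R (mnm1 i))) ->
  (forall p q, Q p -> Q q -> Q (p + q)) ->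
  (forall p q, Q p -> Q q -> Q (p * q)) ->
  forall p, Q p.
Proof.
move=> QC QX QD QM p; rewrite (mpolyE p).
apply: (@big_ind _ Q) => [||m _]; [by rewrite -(mpolyC0 n R)|exact: QD|].
 rewrite -mul_mpolyC; apply: (QM) => //.
rewrite mpolyXE_id; apply: (@big_ind _ Q) => [||i _]; [exact: QC 1|exact: QM|].
move: (fun_of_multinom m i) => k; elim: k => [|k IH]; first exact: QC 1.
by rewrite exprS; apply: QM.
Qed.

(** The closed loop combines polynomials in the state, constant matrices and a separate disturbance.
    Generating such functions from constants and coordinates keeps the two arguments apart and
    provides an induction for continuity and Lipschitz bounds. *)
Inductive polyfun (R : realType) (n p : nat) :
    ('cV[R]_n -> 'cV[R]_p -> R) -> Prop :=
| polyfun_cst c : polyfun (fun _ _ => c)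
| polyfun_fst i : polyfun (fun x _ => x i 0)
| polyfun_snd i : polyfun (fun _ v => v i 0)
| polyfun_add f g : polyfun f -> polyfun g -> polyfun (fun x v => f x v + g x v)
| polyfun_mul f g : polyfun f -> polyfun g -> polyfun (fun x v => f x v * g x v).

Lemma polyfun_ext (R : realType) (n p : nat) (f g : 'cV[R]_n -> 'cV[R]_p -> R) :
  (forall x v, g x v = f x v) -> polyfun f -> polyfun g.
Proof.
by move=> fg; suff -> : g = f by []; apply/funext => x; apply/funext.
Qed.

Lemma polyfun_pev (R : realType) (n p : nat) (q : mpoly n R) :
  polyfun (fun (x : 'cV[R]_n) (_ : 'cV[R]_p) => pev q x).
Proof.
move: q; apply: mpoly_ring_ind => [c|i|q r Hq Hr|q r Hq Hr].
- apply: (@polyfun_ext _ _ _ (fun _ _ => c)); first by move=> x v; rewrite /pev mevalC.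
  exact: polyfun_cst.
- apply: (@polyfun_ext _ _ _ (fun x _ => x i 0)); first by move=> x v; rewrite /pev mevalXU.
  exact: polyfun_fst.
- apply: (@polyfun_ext _ _ _ (fun x v => pev q x + pev r x)); first by move=> x v; rewrite /pev mevalD.
  exact: polyfun_add Hq Hr.
- apply: (@polyfun_ext _ _ _ (fun x v => pev q x * pev r x)); first by move=> x v; rewrite /pev mevalM.
  exact: polyfun_mul Hq Hr.
Qed.

Definition polyfun_mx (R : realType) (n p k l : nat)
    (F : 'cV[R]_n -> 'cV[R]_p -> 'M[R]_(k, l)) : Prop :=
  forall i j, polyfun (fun x v => F x v i j).

Lemma polyfun_mev (R : realType) (n p k l : nat) (S : 'M[mpoly n R]_(k, l)) :
  polyfun_mx (fun (x : 'cV[R]_n) (_ : 'cV[R]_p) => mev S x).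
Proof.
move=> i j; apply: (@polyfun_ext _ _ _ (fun x _ => pev (S i j) x)); first by move=> x v; rewrite mxE.
exact: polyfun_pev.
Qed.

Lemma polyfun_cst_mx (R : realType) (n p k l : nat) (S : 'M[R]_(k, l)) :
  polyfun_mx (fun (_ : 'cV[R]_n) (_ : 'cV[R]_p) => S).
Proof. by move=> i j; exact: polyfun_cst. Qed.

Lemma polyfun_sum (R : realType) (n p k : nat)
    (f : 'I_k -> 'cV[R]_n -> 'cV[R]_p -> R) :
  (forall i, polyfun (f i)) -> polyfun (fun x v => \sum_(i < k) f i x v).
Proof.
elim: k f => [|k IH] f Hf.
  apply: (@polyfun_ext _ _ _ (fun _ _ => 0)); first by move=> x v; rewrite big_ord0.
  exact: polyfun_cst.
apply: (@polyfun_ext _ _ _ (fun x v => f ord0 x v + \sum_(i < k) f (lift ord0 i) x v)).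
  by move=> x v; rewrite big_ord_recl.
by apply: polyfun_add; [exact: Hf|exact: (IH (fun i => f (lift ord0 i)))].
Qed.

Lemma polyfun_mulmx (R : realType) (n p k l q : nat)
    (F : 'cV[R]_n -> 'cV[R]_p -> 'M[R]_(k, l)) (G : _ -> _ -> 'M[R]_(l, q)) :
  polyfun_mx F -> polyfun_mx G -> polyfun_mx (fun x v => F x v *m G x v).
Proof.
move=> HF HG i j.
apply: (@polyfun_ext _ _ _ (fun x v => \sum_r F x v i r * G x v r j)); first by move=> x v; rewrite mxE.
by apply: (polyfun_sum (f := fun r x v => _)) => r; exact: polyfun_mul.
Qed.

Lemma polyfun_addmx (R : realType) (n p k l : nat)
    (F G : 'cV[R]_n -> 'cV[R]_p -> 'M[R]_(k, l)) :
  polyfun_mx F -> polyfun_mx G -> polyfun_mx (fun x v => F x v + G x v).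
Proof.
move=> HF HG i j.
apply: (@polyfun_ext _ _ _ (fun x v => F x v i j + G x v i j)); first by move=> x v; rewrite mxE.
exact: polyfun_add.
Qed.

Lemma polyfun_col_mx (R : realType) (n p k k' l : nat)
    (F : 'cV[R]_n -> 'cV[R]_p -> 'M[R]_(k, l)) (G : _ -> _ -> 'M[R]_(k', l)) :
  polyfun_mx F -> polyfun_mx G -> polyfun_mx (fun x v => col_mx (F x v) (G x v)).
Proof.
move=> HF HG i j; case: (split_ordP i) => r ->.
  apply: (@polyfun_ext _ _ _ (fun x v => F x v r j)); first by move=> x v; rewrite col_mxEu.
  by [].
apply: (@polyfun_ext _ _ _ (fun x v => G x v r j)); first by move=> x v; rewrite col_mxEd.
by [].
Qed.

Lemma polyfun_continuous (R : realType) (n p : nat) (T : topologicalType)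
    (f : 'cV[R]_n -> 'cV[R]_p -> R) (x : T -> 'cV[R]_n) (v : T -> 'cV[R]_p) (t : T) :
  polyfun f -> {for t, continuous x} -> {for t, continuous v} ->
  {for t, continuous (fun s => f (x s) (v s))}.
Proof.
move=> Hf cx cv; elim: Hf => [c|i|i|{}f g _ cf _ cg|{}f g _ cf _ cg].
- exact: cst_continuous.
- exact: (continuous_colP _ _).1.
- exact: (continuous_colP _ _).1.
- exact: (cvgD cf cg).
- exact: (cvgM cf cg).
Qed.

(** Bound and Lipschitz constant are proved together, because the constant of a product involves the
    bounds of its factors. *)
Lemma polyfun_bound_lip (R : realType) (n p : nat)
    (f : 'cV[R]_n -> 'cV[R]_p -> R) (r : R) :
  polyfun f -> exists B K : R, [/\ 0 <= B, 0 <= K &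
    forall (x y : 'cV[R]_n) (v w : 'cV[R]_p),
    (forall i, `|x i 0| <= r) -> (forall i, `|y i 0| <= r) ->
    (forall i, `|v i 0| <= r) -> (forall i, `|w i 0| <= r) ->
    `|f x v| <= B /\ `|f x v - f y w| <=
      K * (\sum_i `|x i 0 - y i 0| + \sum_i `|v i 0 - w i 0|)].
Proof.
have sum_ge0 k (x y : 'cV[R]_k) : 0 <= \sum_i `|x i 0 - y i 0|.
  by apply: sumr_ge0.
have coord k (x y : 'cV[R]_k) i : `|x i 0 - y i 0| <= \sum_j `|x j 0 - y j 0|.
  by rewrite (bigD1 i)//= lerDl; exact: sumr_ge0.
elim=> [c|i|i|{}f g _ [Bf [Kf [Bf0 Kf0 fP]]] _ [Bg [Kg [Bg0 Kg0 gP]]]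
  |{}f g _ [Bf [Kf [Bf0 Kf0 fP]]] _ [Bg [Kg [Bg0 Kg0 gP]]]].
- exists `|c|, 0; split => // x y v w _ _ _ _; split => //.
  by rewrite subrr normr0 mul0r.
- exists `|r|, 1; split => // x y v w xr _ _ _; split.
    by rewrite (le_trans (xr i))// ler_norm.
  by rewrite mul1r (le_trans (coord _ x y i))// lerDl.
- exists `|r|, 1; split => // x y v w _ _ vr _; split.
    by rewrite (le_trans (vr i))// ler_norm.
  by rewrite mul1r (le_trans (coord _ v w i))// lerDr.
- exists (Bf + Bg), (Kf + Kg); split; [exact: addr_ge0|exact: addr_ge0|].
  move=> x y v w xr yr vr wr.
  have [fB fL] := fP x y v w xr yr vr wr; have [gB gL] := gP x y v w xr yr vr wr.
  split; first by rewrite (le_trans (ler_normD _ _))// lerD.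
  rewrite opprD addrACA mulrDl.
  by rewrite (le_trans (ler_normD _ _))// lerD.
- exists (Bf * Bg), (Bf * Kg + Kf * Bg).
  split; [exact: mulr_ge0|by rewrite addr_ge0// mulr_ge0|].
  move=> x y v w xr yr vr wr.
  have [fB fL] := fP x y v w xr yr vr wr; have [gB gL] := gP x y v w xr yr vr wr.
  have [gB' _] := gP y y w w yr yr wr wr.
  split; first by rewrite normrM ler_pM.
  set D := \sum_i _ + \sum_i _ in fL gL *.
  have -> : f x v * g x v - f y w * g y w =
    f x v * (g x v - g y w) + (f x v - f y w) * g y w by ring.
  rewrite (le_trans (ler_normD _ _))// !normrM mulrDl lerD//.
    by rewrite -mulrA ler_pM.
  by rewrite mulrAC ler_pM.
Qed.

Lemma polyfun_mx_bound_lip (R : realType) (n p k : nat)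
    (F : 'cV[R]_n -> 'cV[R]_p -> 'cV[R]_k) (r : R) :
  polyfun_mx F -> exists B K : R, [/\ 0 <= B, 0 <= K &
    forall (x y : 'cV[R]_n) (v w : 'cV[R]_p),
    (forall i, `|x i 0| <= r) -> (forall i, `|y i 0| <= r) ->
    (forall i, `|v i 0| <= r) -> (forall i, `|w i 0| <= r) ->
    forall i, `|F x v i 0| <= B /\ `|F x v i 0 - F y w i 0| <=
      K * (\sum_i `|x i 0 - y i 0| + \sum_i `|v i 0 - w i 0|)].
Proof.
move=> HF; have /choice[B BP] := fun i => @polyfun_bound_lip R n p _ r (HF i 0).
have /choice[K KP] := BP.
have B0 i : 0 <= B i by case: (KP i).
have K0 i : 0 <= K i by case: (KP i).
have le_sum (u : 'I_k -> R) i : (forall j, 0 <= u j) -> u i <= \sum_j u j.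
  by move=> u0; rewrite (bigD1 i)//= lerDl; exact: sumr_ge0.
exists (\sum_i B i), (\sum_i K i); split; [exact: sumr_ge0|exact: sumr_ge0|].
move=> x y v w xr yr vr wr i; case: (KP i) => _ _ /(_ x y v w xr yr vr wr)[h1 h2].
split; first by rewrite (le_trans h1)// le_sum.
rewrite (le_trans h2)// ler_wpM2r ?le_sum//.
by rewrite addr_ge0// sumr_ge0.
Qed.

Lemma enormD_coord (R : realType) (k : nat) (x x0 : 'cV[R]_k) (e : R) i :
  enorm (x - x0) <= e -> `|x i 0| <= enorm x0 + e.
Proof.
move=> h; have := coord_le_enorm (x - x0) i; have := coord_le_enorm x0 i.
rewrite !mxE => h1 h2.
have := ler_normD (x0 i 0) (x i 0 - x0 i 0); rewrite addrC subrK; lra.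
Qed.

Lemma sum_dist_le (R : realType) (k : nat) (x y : 'cV[R]_k) :
  \sum_i `|x i 0 - y i 0| <= k%:R * enorm (x - y).
Proof.
apply: (@le_trans _ _ (\sum_(i < k) enorm (x - y))).
  by apply: ler_sum => i _; have := coord_le_enorm (x - y) i; rewrite !mxE.
by rewrite sumr_const card_ord mulr_natl.
Qed.

Lemma polyfun_locally_lipschitz (R : realType) (n p : nat)
    (F : 'cV[R]_n -> 'cV[R]_p -> 'cV[R]_n) :
  polyfun_mx F -> locally_lipschitz F.
Proof.
move=> HF x0 v0; pose r := enorm x0 + enorm v0 + 1.
have [B [K [_ K0 KP]]] := polyfun_mx_bound_lip r HF.
(* The outer [n] comes from bounding the Euclidean norm by a sum over coordinates, [n + p] from the
   reverse comparison for [x - y] and [v - w]. *)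
exists 1, (n%:R * (K * (n%:R + p%:R))); split => // x y v w xe ye ve we.
have x0_ge0 := enorm_ge0 x0; have v0_ge0 := enorm_ge0 v0.
have inx (z : 'cV[R]_n) : enorm (z - x0) <= 1 -> forall i, `|z i 0| <= r.
  by move=> ze i; apply: le_trans (enormD_coord i ze) _; rewrite /r; lra.
have inv (z : 'cV[R]_p) : enorm (z - v0) <= 1 -> forall i, `|z i 0| <= r.
  by move=> ze i; apply: le_trans (enormD_coord i ze) _; rewrite /r; lra.
have {}KP := KP x y v w (inx x xe) (inx y ye) (inv v ve) (inv w we).
apply: le_trans (enorm_le_sum _) _.
apply: (@le_trans _ _ (\sum_(i < n) K * (n%:R + p%:R) * (enorm (x - y) + enorm (v - w)))).
  apply: ler_sum => i _; rewrite !mxE; have [_ h] := KP i; apply: le_trans h _.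
  rewrite -mulrA ler_wpM2l//.
  have := sum_dist_le x y; have := sum_dist_le v w.
  have := enorm_ge0 (x - y); have := enorm_ge0 (v - w).
  have : 0 <= n%:R :> R by []. have : 0 <= p%:R :> R by [].
  set a := enorm _; set c := enorm _ => *; nra.
by rewrite sumr_const card_ord -[leLHS]mulr_natl !mulrA.
Qed.

(** The chain rule, by induction on ring generators: formal and analytic derivatives obey the same
    sum and product rules. *)
Lemma is_derive_pev (R : realType) (n : nat) (q : mpoly n R) (x : R -> 'cV[R]_n)
    (t : R) (d : 'cV[R]_n) :
  is_derive t 1 x d ->
  is_derive t 1 (fun s => pev q (x s)) (\sum_j pev (mderiv j q) (x t) * d j 0).
Proof.
move=> /is_derive_colP dx; move: q; apply: mpoly_ring_ind => [c|i|q r Hq Hr|q r Hq Hr].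
- rewrite (_ : (fun s => pev _ (x s)) = cst c).
    rewrite big1; first exact: is_derive_cst.
    by move=> j _; rewrite mderivC /pev meval0 mul0r.
  by apply/funext => s; rewrite /pev mevalC.
- rewrite (_ : (fun s => pev _ (x s)) = fun s => x s i 0).
    rewrite (bigD1 i)//= big1 ?addr0; last first.
      move=> j /negPf ji; rewrite mderivX mnm1E eq_sym ji scale0r /pev meval0.
      by rewrite mul0r.
    rewrite mderivX mnm1E eqxx scale1r /pev.
    rewrite (_ : mnm_sub (mnm1 i) (mnm1 i) = mnm0); last first.
      by apply/mnmP => j; rewrite mnmBE subnn mnm0E.
    by rewrite mpolyX0 meval1 mul1r.
  by apply/funext => s; rewrite /pev mevalXU.
- rewrite (_ : (fun s => pev _ (x s)) = (fun s => pev q (x s)) + (fun s => pev r (x s))).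
    apply: (is_derive_eq (is_deriveD Hq Hr)).
    by rewrite -big_split; apply: eq_bigr => j _ /=; rewrite mderivD /pev mevalD mulrDl.
  by apply/funext => s; rewrite /pev mevalD.
- rewrite (_ : (fun s => pev _ (x s)) = (fun s => pev q (x s)) * (fun s => pev r (x s))).
    apply: (is_derive_eq (is_deriveM Hq Hr)).
    rewrite /GRing.scale/= !mulr_sumr -big_split; apply: eq_bigr => j _ /=.
    by rewrite mderivM /pev mevalD !mevalM; ring.
  by apply/funext => s; rewrite /pev mevalM.
Qed.

(** * Quadratic forms and the dissipation inequality *)

Definition dot (R : realType) (k : nat) (u v : 'cV[R]_k) : R := (u^T *m v) 0 0.

Lemma dotE (R : realType) (k : nat) (u v : 'cV[R]_k) : dot u v = \sum_i u i 0 * v i 0.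
Proof. by rewrite /dot mxE; apply: eq_bigr => i _; rewrite mxE. Qed.

Lemma dotC (R : realType) (k : nat) (u v : 'cV[R]_k) : dot u v = dot v u.
Proof. by rewrite !dotE; apply: eq_bigr => i _; rewrite mulrC. Qed.

Lemma dotDr (R : realType) (k : nat) (u v w : 'cV[R]_k) :
  dot u (v + w) = dot u v + dot u w.
Proof. by rewrite /dot mulmxDr mxE. Qed.

Lemma dotDl (R : realType) (k : nat) (u v w : 'cV[R]_k) :
  dot (v + w) u = dot v u + dot w u.
Proof. by rewrite !(dotC _ u) dotDr. Qed.

Lemma dotZr (R : realType) (k : nat) (a : R) (u v : 'cV[R]_k) :
  dot u (a *: v) = a * dot u v.
Proof. by rewrite /dot -scalemxAr mxE. Qed.

Lemma dotNr (R : realType) (k : nat) (u v : 'cV[R]_k) : dot u (- v) = - dot u v.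
Proof. by rewrite -scaleN1r dotZr mulN1r. Qed.

Lemma dot0l (R : realType) (k : nat) (v : 'cV[R]_k) : dot 0 v = 0.
Proof. by rewrite /dot trmx0 mul0mx mxE. Qed.

Lemma dot0r (R : realType) (k : nat) (v : 'cV[R]_k) : dot v 0 = 0.
Proof. by rewrite dotC dot0l. Qed.

Lemma dot_mulmx (R : realType) (k l : nat) (A : 'M[R]_(k, l)) u v :
  dot u (A *m v) = dot (A^T *m u) v.
Proof. by rewrite /dot trmx_mul trmxK mulmxA. Qed.

Lemma qformE (R : realType) (k l : nat) (S : 'M[R]_(k, l)) u v :
  (u^T *m S *m v) 0 0 = dot u (S *m v).
Proof. by rewrite /dot mulmxA. Qed.

Lemma dot_col_mx (R : realType) (k l : nat) (u v : 'cV[R]_k) (u' v' : 'cV[R]_l) :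
  dot (col_mx u u') (col_mx v v') = dot u v + dot u' v'.
Proof. by rewrite /dot tr_col_mx mul_row_col mxE. Qed.

Lemma sqr_enorm_dot (R : realType) (k : nat) (u : 'cV[R]_k) : enorm u ^+ 2 = dot u u.
Proof. by rewrite sqr_enorm dotE; apply: eq_bigr => i _; rewrite expr2. Qed.

Lemma dot_sym_block3 (R : realType) (p q r : nat) (S11 : 'M[R]_p)
    (S21 : 'M[R]_(q, p)) (S22 : 'M[R]_q) (S31 : 'M[R]_(r, p))
    (S32 : 'M[R]_(r, q)) (S33 : 'M[R]_r) a b c :
  let v := col_mx a (col_mx b c) in
  dot v (sym_block3 S11 S21 S22 S31 S32 S33 *m v) =
    dot a (S11 *m a) + 2 * dot b (S21 *m a) + dot b (S22 *m b)
    + 2 * dot c (S31 *m a) + 2 * dot c (S32 *m b) + dot c (S33 *m c).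
Proof.
rewrite /sym_block3 /= mul_block_col mul_col_mx mul_block_col mul_row_col.
rewrite add_col_mx !dot_col_mx !dotDr.
rewrite (dot_mulmx S21^T) (dot_mulmx S31^T) (dot_mulmx S32^T) !trmxK.
rewrite (dotC (S21 *m a)) (dotC (S31 *m a)) (dotC (S32 *m b)); ring.
Qed.

Lemma posdef_unitmx (R : realType) (k : nat) (S : 'M[R]_k) :
  posdef S -> S \in unitmx.
Proof.
move=> [Ssym Spos]; rewrite -row_free_unit; apply: inj_row_free => v vS.
apply: contrapT => v0.
have : v^T != 0 by apply/eqP => h; apply: v0; rewrite -[v]trmxK h trmx0.
by move=> /Spos; rewrite trmxK vS mul0mx mxE ltxx.
Qed.

Lemma posdef_inv (R : realType) (k : nat) (S : 'M[R]_k) :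
  posdef S -> posdef (invmx S).
Proof.
move=> pS; have uS := posdef_unitmx pS; have [Ssym Spos] := pS.
have Isym : (invmx S)^T = invmx S by rewrite trmx_inv Ssym.
split => // v v0; rewrite qformE.
have -> : dot v (invmx S *m v) = dot (invmx S *m v) (S *m (invmx S *m v)).
  by rewrite mulKVmx// dotC.
rewrite -qformE; apply: Spos; apply: contra v0 => /eqP h.
by rewrite -[v](mulKVmx uS) h mulmx0.
Qed.

Lemma posdef_cauchy (R : realType) (k : nat) (S : 'M[R]_k) (u v : 'cV[R]_k) :
  posdef S -> dot u (S *m v) ^+ 2 <= dot u (S *m u) * dot v (S *m v).
Proof.
move=> [Ssym Spos].
have sym : dot v (S *m u) = dot u (S *m v) by rewrite dot_mulmx Ssym dotC.
have [->|u0] := eqVneq u 0.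
  by rewrite !dot0l expr0n mul0r.
have a0 : 0 < dot u (S *m u) by rewrite -qformE; exact: Spos.
set a := dot u (S *m u) in a0 *; set b := dot u (S *m v) in sym *.
set c := dot v _.
(* The form at this vector equals [a * (a * c - b ^+ 2)], and [a] is positive. *)
have : 0 <= dot (a *: v - b *: u) (S *m (a *: v - b *: u)).
  have [->|h] := eqVneq (a *: v - b *: u) 0.
    by rewrite dot0l.
  by apply/ltW; rewrite -qformE; exact: Spos.
rewrite -scaleNr mulmxDr -!scalemxAr !dotDr !dotDl !dotZr.
rewrite !(dotC (_ *: _)) !dotZr !(dotC (S *m _)) sym -/a -/b -/c => h.
have : 0 <= a * (a * c - b ^+ 2) by move: h; congr (0 <= _); ring.
by rewrite pmulr_rge0// subr_ge0.
Qed.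

Lemma posdef1 (R : realType) (k : nat) : posdef (1%:M : 'M[R]_k).
Proof.
split; first exact: trmx1.
move=> v v0; rewrite mulmx1 -/(dot v v) -sqr_enorm_dot exprn_gt0//.
rewrite lt_neqAle enorm_ge0 andbT; apply: contra v0 => /eqP h.
apply/eqP/matrixP => i j; rewrite (ord1 j) mxE.
by have := coord_le_enorm v i; rewrite -h normr_le0 => /eqP.
Qed.

Lemma cauchy_schwarz (R : realType) (k : nat) (u v : 'cV[R]_k) :
  dot u v ^+ 2 <= dot u u * dot v v.
Proof. by have := posdef_cauchy u v (@posdef1 R k); rewrite !mul1mx. Qed.

(** The easy direction of the S-procedure. The third component [y] maximizes the form over the last
    block, as in a Schur complement, and so produces the term with [invmx Ab]. *)
Lemma data_consistent (R : realType) (n k T : nat)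
    (l : 'I_T -> 'cV[R]_k) (dxs ds : 'I_T -> 'cV[R]_n) (delta : R)
    (Ab : 'M[R]_k) (Bb : 'M[R]_(k, n)) (tau : 'I_T -> R) (AB : 'M[R]_(n, k)) :
  posdef Ab -> (forall i, 0 <= tau i) ->
  (forall i, dxs i = AB *m l i + ds i) ->
  (forall i, enorm (ds i) ^+ 2 <= delta) ->
  psd_le
    (sym_block3
      (- 1%:M - \sum_(i < T) tau i *: data_C delta (dxs i))
      (Bb - \sum_(i < T) tau i *: data_B (l i) (dxs i))
      (Ab - \sum_(i < T) tau i *: data_A (l i))
      Bb 0 (- Ab)) 0 ->
  Ibar Ab Bb AB.
Proof.
move=> pA tau0 dxE dle [_ lmi]; have uA := posdef_unitmx pA.
have [Asym _] := pA; have [iAsym _] := posdef_inv pA.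
exists AB^T; last exact: trmxK.
split.
  rewrite linearB /= trmx1 !linearD /= !trmx_mul !trmxK Asym iAsym !mulmxA.
  by congr (_ + (_ - _)); rewrite addrAC.
move=> v; rewrite qformE.
set q := AB^T *m v; pose y := invmx Ab *m Bb *m v.
have := lmi (col_mx v (col_mx q y)); rewrite qformE sub0r mulNmx dotNr.
rewrite dot_sym_block3.
have Ay : Ab *m y = Bb *m v by rewrite /y -mulmxA mulKVmx.
rewrite mul0mx dot0r.
rewrite !mulmxBl !mulNmx !mul1mx !dotDr !dotNr Ay.
rewrite !mulmx_suml ?mulmxDl !dotDr.
have -> : dot v (Bb^T *m invmx Ab *m Bb *m v) = dot y (Bb *m v).
  by rewrite /y -!mulmxA dot_mulmx trmxK dotC.
have dot_sum p (u : 'cV[R]_p) (f : 'I_T -> 'cV[R]_p) :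
    dot u (\sum_i f i) = \sum_i dot u (f i).
  by rewrite /dot mulmx_sumr summxE.
rewrite !dot_sum.
have -> : dot v (Bb^T *m AB^T *m v) = dot q (Bb *m v).
  by rewrite -mulmxA dot_mulmx trmxK dotC.
have -> : dot v (AB^T^T *m Bb *m v) = dot q (Bb *m v).
  by rewrite -mulmxA dot_mulmx trmxK.
have -> : dot v (AB^T^T *m Ab *m AB^T *m v) = dot q (Ab *m q).
  by rewrite -!mulmxA dot_mulmx trmxK.
(* By the data equation the summand of index [i] is [tau i * (dot (ds i) v ^+ 2 - delta * dot v v)],
   nonpositive by Cauchy-Schwarz and the noise bound. *)
have datum : \sum_i dot v ((tau i *: data_C delta (dxs i)) *m v)
    + 2 * \sum_i dot q ((tau i *: data_B (l i) (dxs i)) *m v)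
    + \sum_i dot q ((tau i *: data_A (l i)) *m q) <= 0.
  rewrite mulr_sumr -!big_split /=; apply: sumr_le0 => i _.
  rewrite -!scalemxAl !dotZr /data_C /data_B /data_A.
  rewrite mulmxBl mulNmx mul_scalar_mx !dotDr !dotNr dotZr.
  have dyad p p' (u v' : 'cV[R]_p) (u' w : 'cV[R]_p') :
      dot v' (u *m u'^T *m w) = dot v' u * dot u' w.
    rewrite -mulmxA (_ : u'^T *m w = (dot u' w)%:M); last first.
      by apply/matrixP => a b; rewrite !ord1 [RHS]mxE mulr1n.
    by rewrite mul_mx_scalar dotZr mulrC.
  rewrite !dyad.
  have dv : dot (dxs i) v = dot q (l i) + dot (ds i) v.
    by rewrite dxE dotDl /q dotC -(trmxK AB) dot_mulmx trmxK.
  rewrite [dot v _]dotC [dot (l i) _]dotC dv.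
  have := cauchy_schwarz (ds i) v; rewrite -sqr_enorm_dot.
  have v0 : 0 <= dot v v by rewrite -sqr_enorm_dot sqr_ge0.
  have := ler_wpM2r v0 (dle i) => h1 h2.
  have h3 : dot (ds i) v ^+ 2 - delta * dot v v <= 0 by lra.
  have := mulr_ge0_le0 (tau0 i) h3; congr (_ <= 0); ring.
move: datum; set s1 := \sum_i _; set s2 := \sum_i _; set s3 := \sum_i _; lra.
Qed.

(** Completing the square: the inequality defining [Ibar] bounds [D^T *m Ab *m D] by the identity,
    where [D = zeta + invmx Ab *m Bb]. *)
Lemma Ibar_dist (R : realType) (n k : nat) (Ab : 'M[R]_k) (Bb : 'M[R]_(k, n))
    (zeta : 'M[R]_(k, n)) (u : 'cV[R]_n) :
  posdef Ab -> Ibar Ab Bb zeta^T ->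
  let y := (zeta + invmx Ab *m Bb) *m u in dot y (Ab *m y) <= dot u u.
Proof.
move=> pA [z [_ /(_ u) h] /trmx_inj zE] /=; move: h; rewrite {z}zE.
have uA := posdef_unitmx pA; have [Asym _] := pA; have [iAsym _] := posdef_inv pA.
rewrite qformE mulmxBl mul1mx dotDr dotNr subr_ge0; apply: le_trans.
rewrite le_eqVlt; apply/orP; left; apply/eqP.
have -> : dot ((zeta + invmx Ab *m Bb) *m u) (Ab *m ((zeta + invmx Ab *m Bb) *m u))
    = dot u ((zeta + invmx Ab *m Bb)^T *m Ab *m (zeta + invmx Ab *m Bb) *m u).
  by rewrite -!mulmxA [RHS]dot_mulmx trmxK.
congr (dot u (_ *m u)).
rewrite [(_ + _)^T]linearD /= trmx_mul iAsym !mulmxDl !mulmxDr !mulmxA.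
rewrite !mulmxKV// mulmxK//.
by rewrite addrC [X in _ + X]addrC addrA [X in X + _ + _]addrC.
Qed.

Lemma mevM (R : realType) (n k l q : nat) (A : 'M[mpoly n R]_(k, l))
    (B : 'M[mpoly n R]_(l, q)) x : mev (A *m B) x = mev A x *m mev B x.
Proof.
apply/matrixP => i j; rewrite !mxE /pev raddf_sum; apply: eq_bigr => r _.
by rewrite !mxE /= rmorphM.
Qed.

Lemma sos_mx_ge0 (R : realType) (n k : nat) (S : 'M[mpoly n R]_k) x v :
  sos_mx S -> 0 <= dot v (mev S x *m v).
Proof.
move=> [l [Q ->]]; rewrite mevM.
have -> : mev Q^T x = (mev Q x)^T by apply/matrixP => i j; rewrite !mxE.
by rewrite -mulmxA dot_mulmx trmxK -sqr_enorm_dot sqr_ge0.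
Qed.

Lemma sos_ge0 (R : realType) (n : nat) (q : mpoly n R) x : sos q -> 0 <= pev q x.
Proof.
move=> [qs ->]; rewrite /pev raddf_sum; apply: sumr_ge0 => r _.
by rewrite /= rmorphXn sqr_ge0.
Qed.

(* Evaluating the LMI of the design at (z, w, (zeta - zetab) J^T z) replaces  *)
(* zetab by an arbitrary zeta of the uncertainty set.                         *)
Lemma dissipation (R : realType) (n m k Nh : nat) (Ab : 'M[R]_k)
    (Bb zeta : 'M[R]_(k, n)) (L : 'M[R]_(k, Nh)) (E : 'M[R]_(k, m))
    (J : 'M[R]_(Nh, n)) (Theta : 'M[R]_Nh) (G : 'M[R]_m) (lam : R) z w :
  posdef Ab -> Ibar Ab Bb zeta^T -> 0 <= lam ->
  (forall v, dot v (sym_block3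
     (Tp (L^T *m - (invmx Ab *m Bb) *m J^T) + Theta + lam *: (J *m 1%:M *m J^T))
     (E^T *m - (invmx Ab *m Bb) *m J^T) (- G) L E (- (lam *: Ab)) *m v) <= 0) ->
  2 * dot z (J *m (zeta^T *m (L *m z + E *m w)))
    <= - dot z (Theta *m z) + dot w (G *m w).
Proof.
move=> pA Iz lam0; set zb := - (invmx Ab *m Bb) => lmi.
set u := J^T *m z; pose y := (zeta - zb) *m u.
have yA : dot y (Ab *m y) <= dot u u.
  by have := Ibar_dist u pA Iz; rewrite /y /zb opprK.
have := lmi (col_mx z (col_mx w y)); rewrite dot_sym_block3.
rewrite /Tp !mulmxDl !mulNmx !dotDr !dotNr.
rewrite -!scalemxAl !dotZr mulmx1.
have -> : dot z (L^T *m zb *m J^T *m z) = dot (L *m z) (zb *m u).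
  by rewrite -!mulmxA dot_mulmx trmxK.
have -> : dot z ((L^T *m zb *m J^T)^T *m z) = dot (L *m z) (zb *m u).
  by rewrite dot_mulmx trmxK dotC -!mulmxA dot_mulmx trmxK.
have -> : dot z (J *m J^T *m z) = dot u u by rewrite -mulmxA dot_mulmx.
have -> : dot w (E^T *m zb *m J^T *m z) = dot (E *m w) (zb *m u).
  by rewrite -!mulmxA dot_mulmx trmxK.
have -> : dot z (J *m (zeta^T *m (L *m z + E *m w))) =
    dot (L *m z) (zeta *m u) + dot (E *m w) (zeta *m u).
  by rewrite dot_mulmx dot_mulmx trmxK dotDr ![dot (zeta *m _) _]dotC.
rewrite ![dot y (_ *m _ : 'cV_k)]dotC.
(* The cross terms with [y] replace [zb *m u] by [zeta *m u]; the terms in [lam] add up to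
   [lam * (dot u u - dot y (Ab *m y))], which is nonnegative. *)
have yE g : dot g y = dot g (zeta *m u) - dot g (zb *m u).
  by rewrite /y mulmxBl dotDr dotNr.
rewrite [dot (Ab *m y) y]dotC !yE.
have := ler_wpM2l lam0 yA; lra.
Qed.

(** * The closed-loop system *)

Lemma polyfun_trmx (R : realType) (n p k l : nat)
    (F : 'cV[R]_n -> 'cV[R]_p -> 'M[R]_(k, l)) :
  polyfun_mx F -> polyfun_mx (fun x v => (F x v)^T).
Proof.
move=> HF i j; apply: (@polyfun_ext _ _ _ (fun x v => F x v j i)) => //.
by move=> x v; rewrite mxE.
Qed.

(** A function of the state alone is treated as one with an input of dimension 0. *)
Lemma polyfun_mx_continuous1 (R : realType) (n k l : nat)
    (F : 'cV[R]_n -> 'cV[R]_0 -> 'M[R]_(k, l)) i j :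
  polyfun_mx F -> continuous (fun x => F x 0 i j).
Proof.
move=> HF x; apply: (polyfun_continuous (x := id) (v := fun=> 0) (HF i j)).
  by move=> A.
exact: cst_continuous.
Qed.

Lemma is_derive_qform (R : realType) (k : nat) (C : 'M[R]_k) (z : R -> 'cV[R]_k)
    (t : R) (d : 'cV[R]_k) :
  C^T = C -> is_derive t 1 z d ->
  is_derive t 1 (fun s => ((z s)^T *m C *m z s) 0 0) (2 * dot (C *m z t) d).
Proof.
move=> Csym /is_derive_colP dz.
rewrite (_ : (fun s => _) =
  \sum_(i < k) \sum_(j < k) (fun s => C i j * (z s i 0 * z s j 0))); last first.
  apply/funext => s; rewrite qformE dotE fct_sumE; apply: eq_bigr => i _.
  rewrite fct_sumE mxE mulr_sumr; apply: eq_bigr => j _; ring.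
have dij i j : is_derive t 1 (fun s => C i j * (z s i 0 * z s j 0))
    (z t i 0 * (C i j * d j 0) + d i 0 * (C i j * z t j 0)).
  apply: (is_derive_eq (is_deriveZ (C i j) (is_deriveM (dz i) (dz j)))).
  by rewrite /GRing.scale/=; ring.
have := is_derive_sum (fun i => is_derive_sum (fun j => dij i j)).
rewrite (_ : \sum_i \sum_j _ = 2 * dot (C *m z t) d) //.
have -> : 2 * dot (C *m z t) d = dot (z t) (C *m d) + dot d (C *m z t).
  rewrite (dotC d) [dot (z t) _]dot_mulmx Csym; ring.
rewrite !dotE -big_split; apply: eq_bigr => i _ /=.
by rewrite !mxE !mulr_sumr -big_split.
Qed.

Lemma qform_bound (R : realType) (k : nat) (C : 'M[R]_k) (w : 'cV[R]_k) :
  dot w (C *m w) <= (\sum_i \sum_j `|C i j|) * enorm w ^+ 2.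
Proof.
rewrite dotE mulr_suml; apply: ler_sum => i _.
rewrite mxE mulr_sumr mulr_suml; apply: ler_sum => j _.
apply: le_trans (ler_norm _) _; rewrite normrM normrM mulrCA ler_wpM2l//.
by rewrite expr2 ler_pM// coord_le_enorm.
Qed.

(** The summand [r] gives strict monotonicity for any nonnegative [c j]. The other terms are the
    bounds of [qform_bound] for the coefficients of [Gamma], with [r] in place of [enorm w]. *)
Lemma class_K_even_poly (R : realType) (k : nat) (c : 'I_k -> R) :
  (forall j, 0 <= c j) ->
  class_K (fun r => r + \sum_(j < k) r ^+ (2 * j) * (c j * r ^+ 2)).
Proof.
move=> c0; split.
- apply: continuous_subspaceT => r; apply: cvgD; first exact: cvg_id.
  have h : continuous (fun r : R => \sum_(j < k) r ^+ (2 * j) * (c j * r ^+ 2)).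
    apply: continuous_big => [|j _ s]; first exact: add_continuous.
    apply: cvgM; first exact: exprn_continuous.
    by apply: cvgMr; exact: exprn_continuous.
  exact: h.
- move=> r s; rewrite !in_itv/= !andbT => r0 s0 rs.
  apply: ltr_leD => //; apply: ler_sum => j _.
  have rs' := ltW rs.
  have h e : r ^+ e <= s ^+ e by rewrite lerXn2r.
  apply: ler_pM; rewrite ?exprn_ge0 ?mulr_ge0 ?exprn_ge0//.
  by rewrite ler_wpM2l.
- by rewrite big1 ?addr0// => j _; rewrite expr2 !mulr0.
Qed.

Lemma closed_loop_ISS (R : realType) (n m N M Nh : nat)
    (H : 'M[mpoly n R]_(N, Nh)) (Zh : 'cV[mpoly n R]_Nh)
    (W : 'M[mpoly n R]_(M, m)) (Y : 'M[mpoly n R]_(m, Nh)) (P : 'M[R]_Nh)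
    (Xi : 'M[mpoly n R]_Nh) (eta : R) (AB : 'M[R]_(n, N + M)) (sg : R -> R) :
  let b (x : 'cV[R]_n) :=
    ((mev Zh x)^T *m invmx P *m mev Xi x *m invmx P *m mev Zh x) 0 0 in
  (forall x, mev Zh x = 0 <-> x = 0) ->
  radially_unbounded (fun x => enorm (mev Zh x)) ->
  posdef P -> 0 < eta ->
  positive_definite b -> radially_unbounded b -> class_K sg ->
  (forall x w, 2 * dot (invmx P *m mev Zh x)
       (mev (jacobian_mx Zh) x *m closed_loop H Zh W Y P AB x w)
     <= - (eta * b x) + sg (enorm w)) ->
  ISS (closed_loop H Zh W Y P AB).
Proof.
move=> b Zh0 radZ pP eta0 pb rb Ksg diss.
have pI := posdef_inv pP; have uP := posdef_unitmx pP.
have [Isym Ipos] := pI.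
pose V x := ((mev Zh x)^T *m invmx P *m mev Zh x) 0 0.
have pF : polyfun_mx (closed_loop H Zh W Y P AB).
  apply: polyfun_mulmx; first exact: polyfun_cst_mx.
  apply: polyfun_col_mx; apply: polyfun_mulmx; try exact: polyfun_mev.
  apply: polyfun_addmx; last by move=> i j; rewrite (ord1 j); exact: polyfun_snd.
  apply: polyfun_mulmx; last exact: polyfun_mev.
  by apply: polyfun_mulmx; [exact: polyfun_mev|exact: polyfun_cst_mx].
have pZt : polyfun_mx (fun (x : 'cV[R]_n) (_ : 'cV[R]_0) => (mev Zh x)^T *m invmx P).
  apply: polyfun_mulmx; last exact: polyfun_cst_mx.
  by apply: polyfun_trmx; exact: polyfun_mev.
apply: (@lyapunov_ISS R n m (closed_loop H Zh W Y P AB) V (fun x => eta * b x) sg).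
- by rewrite /closed_loop (Zh0 0).2// !mulmx0 addr0 mulmx0 col_mx0 mulmx0.
- exact: polyfun_locally_lipschitz.
- move=> r; have [B [K [_ _ BK]]] := polyfun_mx_bound_lip r pF.
  exists B, K => x y v xr yr vr i.
  have vr' j : `|v j 0| <= r by apply: le_trans vr; exact: coord_le_enorm.
  have [h1 h2] := BK x y v v xr yr vr' vr' i; split => //.
  by move: h2; rewrite [X in _ * (_ + X)]big1 ?addr0// => j _; rewrite subrr normr0.
- move=> x v t cx cv; apply/continuous_colP => i.
  exact: (polyfun_continuous (pF i 0)).
- apply: (@polyfun_mx_continuous1 _ _ _ _ (fun x _ => (mev Zh x)^T *m invmx P *m mev Zh x)).
  by apply: polyfun_mulmx => //; exact: polyfun_mev.
- split; first by rewrite /V (Zh0 0).2// mulmx0 mxE.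
  move=> x x0; apply: Ipos; apply/eqP => /(Zh0 x).1 h.
  by rewrite h eqxx in x0.
- move=> K; pose tr := \sum_i P i i.
  (* Cauchy-Schwarz for the form [P] between a basis vector and [P^-1 Zh(x)]. Summed over [i], the
     trace of [P] plays the role of its largest eigenvalue. *)
  have PV x i : (mev Zh x) i 0 ^+ 2 <= P i i * V x.
    have := posdef_cauchy (delta_mx i 0) (invmx P *m mev Zh x) pP.
    rewrite mulKVmx//.
    have dE (u : 'cV[R]_Nh) : dot (delta_mx i 0) u = u i 0.
      rewrite dotE (bigD1 i)//= big1 ?addr0.
        by rewrite mxE !eqxx mul1r.
      by move=> j /negPf ji; rewrite mxE ji mul0r.
    by rewrite !dE -colE [col i P i 0]mxE /V qformE [dot (invmx P *m _) _]dotC.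
  have trV x : enorm (mev Zh x) ^+ 2 <= tr * V x.
    by rewrite sqr_enorm mulr_suml; apply: ler_sum.
  have V_ge0 x : 0 <= V x.
    have [h|h] := eqVneq (mev Zh x) 0; first by rewrite /V h mulmx0 mxE.
    exact/ltW/Ipos.
  have tr0 : 0 <= tr.
    apply: sumr_ge0 => i _; have [_ Ppos] := pP.
    have [->//|Pii] := eqVneq (P i i) 0.
    apply/ltW; have := Ppos (delta_mx i 0); rewrite qformE -colE /dot.
    rewrite trmx_delta -rowE !mxE; apply; apply/eqP => /matrixP/(_ i 0).
    by rewrite !mxE !eqxx => /eqP; rewrite oner_eq0.
  (* The last 1 makes the square of the norm dominate [|K| * (tr + 1)]; [tr + 1] is positive even
     when [Nh] is 0, so it can be divided out. *)
  have [r rP] := radZ (`|K| * (tr + 1) + 1).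
  exists r => x /rP h.
  have h0 : 0 <= `|K| * (tr + 1) by rewrite mulr_ge0// addr_ge0.
  have := trV x; have := V_ge0 x; have := ler_norm K => ? ? ?.
  have h1 : `|K| * (tr + 1) <= enorm (mev Zh x) ^+ 2 by nra.
  have : `|K| * (tr + 1) <= V x * (tr + 1) by nra.
  by rewrite ler_pM2r; lra.
- suff cb : continuous b.
    move=> x.
    exact: (@continuous_comp _ _ _ b ( *%R eta) x (cb x) (@mulrl_continuous R eta (b x))).
  apply: (@polyfun_mx_continuous1 _ _ _ _
    (fun x _ => (mev Zh x)^T *m invmx P *m mev Xi x *m invmx P *m mev Zh x)).
  apply: polyfun_mulmx; last exact: polyfun_mev.
  apply: polyfun_mulmx; last exact: polyfun_cst_mx.
  by apply: polyfun_mulmx => //; exact: polyfun_mev.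
- have [b0 bp] := pb; split; first by rewrite b0 mulr0.
  by move=> x x0; rewrite mulr_gt0// bp.
- move=> K; have [r rP] := rb (K / eta); exists r => x /rP.
  by rewrite ler_pdivrMr// mulrC.
- exact: Ksg.
move=> x t w dx; pose d := mev (jacobian_mx Zh) (x t) *m closed_loop H Zh W Y P AB (x t) w.
exists (2 * dot (invmx P *m mev Zh (x t)) d); last exact: diss.
apply: is_derive_qform => //; apply/is_derive_colP => i.
rewrite (_ : (fun s => _) = fun s => pev (Zh i 0) (x s)); last first.
  by apply/funext => s; rewrite mxE.
rewrite (_ : d i 0 = \sum_j pev (mderiv j (Zh i 0)) (x t) *
  closed_loop H Zh W Y P AB (x t) w j 0); first exact: is_derive_pev.
by rewrite mxE; apply: eq_bigr => j _; rewrite !mxE.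
Qed.

Theorem theorem4p5 (R : realType) (n m N M Nh T : nat)
    (* libraries and actual system *)
    (Z : 'cV[mpoly n R]_N) (W : 'M[mpoly n R]_(M, m))
    (Z_monomial : forall i, is_monomial (Z i 0))
    (W_monomial : forall i j, is_monomial (W i j))
    (Z0 : mev Z 0 = 0)
    (Astar : 'M[R]_(n, N)) (Bstar : 'M[R]_(n, M))
    (* reduced library *)
    (Zh : 'cV[mpoly n R]_Nh) (H : 'M[mpoly n R]_(N, Nh))
    (ZhH : reduced_library Z Zh H)
    (* data *)
    (us : 'I_T -> 'cV[R]_m) (xs dxs ds : 'I_T -> 'cV[R]_n) (delta : R)
    (delta_gt0 : 0 < delta)
    (dataE : forall i,
       dxs i = Astar *m mev Z (xs i) + Bstar *m mev W (xs i) *m us i + ds i)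
    (noise_bound : forall i, enorm (ds i) ^+ 2 <= delta)
    (* optimization program *)
    (opt_is_feasible : exists Ab Bb tau,
       opt_feasible Z W delta us xs dxs Ab Bb tau)
    (Ab : 'M[R]_(N + M)) (Bb : 'M[R]_(N + M, n)) (tau : 'I_T -> R)
    (opt_sol : opt_solution Z W delta us xs dxs Ab Bb tau)
    (* design *)
    (Xi : 'M[mpoly n R]_Nh) (Xi_sym : Xi^T = Xi)
    (eps : R) (eps_gt0 : 0 < eps)
    (P : 'M[R]_Nh) (P_posdef : posdef P)
    (Y : 'M[mpoly n R]_(m, Nh)) (Gamma : 'M[{poly R}]_m)
    (Theta : 'M[mpoly n R]_Nh) (Theta_sym : Theta^T = Theta)
    (eta : R) (eta_gt0 : 0 < eta)
    (lambda s_lambda : mpoly (n + m) R) (s_lambda_sos : sos s_lambda)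
    (S_Theta : 'M[mpoly n R]_Nh) (S_Theta_sos : sos_mx S_Theta)
    (S_d : 'M[mpoly (n + m) R]_(Nh + (m + (N + M)))) (S_d_sos : sos_mx S_d)
    (cond_a : exists (nu : nat) (C : 'I_nu.+1 -> 'M[R]_m),
       [/\ forall j, psd (C j),
           psd_le eps%:M (\sum_(j < nu.+1) C j)
         & forall r : R,
             map_mx (fun p => p.[r]) Gamma
             = \sum_(j < nu.+1) r ^+ (2 * j) *: C j])
    (cond_b : forall (x : 'cV[R]_n) (w : 'cV[R]_m),
       pev lambda (col_mx x w) - eps = pev s_lambda (col_mx x w))
    (cond_c : forall x : 'cV[R]_n,
       mev Theta x - eta *: mev Xi x = mev S_Theta x)
    (cond_d : forall (x : 'cV[R]_n) (w : 'cV[R]_m),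
       let zetab : 'M[R]_(N + M, n) := - (invmx Ab *m Bb) in
       let Qb : 'M[R]_n := 1%:M in
       let L := col_mx (mev H x *m P) (mev W x *m mev Y x) in
       let E : 'M[R]_(N + M, m) := col_mx 0 (mev W x) in
       let J := mev (jacobian_mx Zh) x in
       let lam := pev lambda (col_mx x w) in
       sym_block3
         (Tp (L^T *m zetab *m J^T) + mev Theta x + lam *: (J *m Qb *m J^T))
         (E^T *m zetab *m J^T) (- map_mx (fun p => p.[enorm w]) Gamma)
         L E (- (lam *: Ab))
       = - mev S_d (col_mx x w)) :
  let b (x : 'cV[R]_n) : R :=
    ((mev Zh x)^T *m invmx P *m mev Xi x *m invmx P *m mev Zh x) 0 0 in
  positive_definite b ->
  radially_unbounded b ->
  (forall (A : 'M[R]_(n, N)) (B : 'M[R]_(n, M)),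
     Ibar Ab Bb (row_mx A B) ->
     ISS (closed_loop H Zh W Y P (row_mx A B)))
  /\ ISS (closed_loop H Zh W Y P (row_mx Astar Bstar)).
Proof.
move=> b pb rb.
have [nu [C [Cpsd _ GammaE]]] := cond_a.
have [[pA tau0 lmi] _] := opt_sol.
have [Zh0 _ radZ] := ZhH.
pose c j : R := \sum_i \sum_k `|C j i k|.
have c0 j : 0 <= c j by apply: sumr_ge0 => i _; exact: sumr_ge0.
suff iss (AB : 'M[R]_(n, N + M)) : Ibar Ab Bb AB ->
    ISS (closed_loop H Zh W Y P AB).
  split; first by move=> A B; exact: iss.
  apply: iss.
  apply: (@data_consistent R n (N + M) T (fun i => data_ell Z W (xs i) (us i))
    dxs ds delta Ab Bb tau) => // i.
  by rewrite dataE /data_ell mul_row_col mulmxA.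
move=> IAB; pose sg (r : R) := r + \sum_(j < nu.+1) r ^+ (2 * j) * (c j * r ^+ 2).
apply: (@closed_loop_ISS R n m N M Nh H Zh W Y P Xi eta AB sg Zh0 radZ P_posdef
  eta_gt0 pb rb (class_K_even_poly c0)).
move=> x w; set z := invmx P *m mev Zh x.
have uP := posdef_unitmx P_posdef; have [Isym _] := posdef_inv P_posdef.
pose L := col_mx (mev H x *m P) (mev W x *m mev Y x).
pose E : 'M[R]_(N + M, m) := col_mx 0 (mev W x).
(* Writing [Zh(x) = P z] turns [H Zh] into [H P z] and the feedback into [Y z]: this is the origin
   of the factor [P] in [L]. *)
have -> : closed_loop H Zh W Y P AB x w = AB^T^T *m (L *m z + E *m w).
  rewrite trmxK /closed_loop /L /E !mul_col_mx mul0mx add_col_mx addr0.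
  by rewrite -!mulmxA mulKVmx// -mulmxDr.
have lam0 : 0 <= pev lambda (col_mx x w).
  have := sos_ge0 (col_mx x w) s_lambda_sos; rewrite -cond_b; lra.
have lmi_d v := sos_mx_ge0 (col_mx x w) v S_d_sos.
have := @dissipation R n m (N + M) Nh Ab Bb AB^T L E (mev (jacobian_mx Zh) x)
  (mev Theta x) (map_mx (fun p => p.[enorm w]) Gamma) (pev lambda (col_mx x w)) z w
  pA.
rewrite trmxK => /(_ IAB lam0) diss.
apply: (le_trans (diss _)).
  by move=> v; rewrite cond_d mulNmx dotNr oppr_le0.
apply: lerD.
  (* By condition (c) the form of [Theta] at [z] is at least [eta] times that of [Xi], which is
     [b x]. *)
  rewrite lerN2 -/(b x).
  have -> : b x = dot z (mev Xi x *m z).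
    by rewrite /b /dot /z trmx_mul Isym !mulmxA.
  have := sos_mx_ge0 x z S_Theta_sos; rewrite -cond_c mulmxBl dotDr dotNr.
  by rewrite -scalemxAl dotZr subr_ge0.
(* The linear summand of [sg] is compared with 0, and the sum over [j] term by term. *)
rewrite GammaE mulmx_suml -[leLHS]add0r; apply: lerD; first exact: enorm_ge0.
rewrite /dot mulmx_sumr summxE; apply: ler_sum => j _.
rewrite -/(dot _ _) -scalemxAl dotZr.
by rewrite ler_wpM2l ?exprn_ge0 ?enorm_ge0//; exact: qform_bound.
Qed.
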